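(* Let $1<p<\infty$ and $X=L_p(\mu)$ (complex scalars) for some measure space $(\Omega,\Sigma,\mu)$. Then the set of all functions in $A(B_X:X)$ that are both norm strong peak functions and numerical strong peak functions is a dense $G_\delta$-subset of $A(B_X:X)$. In particular, every numerical strong peak function in $A(B_X:X)$ is a very strong numerical peak function.
   Context: $B_X,S_X$ are the closed unit ball and unit sphere. $A_b(B_X:X)$ is the Banach space (sup norm $\|f\|=\sup_{x\in B_X}\|f(x)\|$) of bounded continuous functions $f:B_X\to X$ holomorphic on the open unit ball; $A_u(B_X:X)$ is its closed subspace of uniformly continuous functions; $A_{wu}(B_X:X)$ is the closed subspace of $A_u(B_X:X)$ of weakly uniformly continuous functions. $A(B_X:X)$ denotes any one of these three spaces (the result holds for each). $\Pi(X)=\{(x,x^* )\in S_X\times S_{X^*}:x^*(x)=1\}$; $\tau$ is the product on $S_X\times S_{X^*}$ of the norm topology of $X$ and the weak-$*$ topology of $X^*$; $v(f)=\sup\{|x^*(f(x))|:(x,x^* )\in\Pi(X)\}$. $f$ is a norm strong peak function at $t\in B_X$ if $t$ is the unique point with $\|f\|=\|f(t)\|$ and every sequence $(t_k)$ in $B_X$ with $\|f(t_k)\|\to\|f\|$ converges in norm to $t$. $f$ is a numerical strong peak function at $(x,x^* )\in\Pi(X)$ if $(x,x^* )$ is the unique element of $\Pi(X)$ with $v(f)=|x^*(f(x))|$ and every sequence $((x_k,x_k^* ))$ in $\Pi(X)$ with $|x_k^*(f(x_k))|\to v(f)$ converges to $(x,x^* )$ in $\tau$; it is a very strong numerical peak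 function if moreover for every such sequence $x_k\to x$ and $x_k^*\to x^*$ in norm. *)

(* Defs.v *)
From HB Require Import structures.
From mathcomp Require Import all_boot all_order all_algebra.
From mathcomp Require Import all_classical all_reals all_analysis.
From mathcomp Require Import measurable_realfun complex.

Set Implicit Arguments.
Unset Strict Implicit.
Unset Printing Implicit Defensive.

Import Order.TTheory GRing.Theory Num.Theory.
Import numFieldNormedType.Exports.

Local Open Scope classical_set_scope.
Local Open Scope ring_scope.
Local Open Scope complex_scope.

Section RealNorm.
Context {R : realType}.

(* A normed R[i]-module has an R[i]-valued norm, whose values are real. *)
Definition rnorm {V : normedModType R[i]} (x : V) : R := complex.Re `|x|.

Context {V : normedModType R[i]}.
Implicit Types (x y : V) (a : R[i]).

Lemma rnormE x : (rnorm x)%:C = `|x|.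
Proof. by apply: RRe_real; apply: ger0_real; exact: normr_ge0. Qed.

Lemma rnorm_ge0 x : 0 <= rnorm x.
Proof. by rewrite -lecR rnormE; exact: normr_ge0. Qed.

Lemma rnorm0 : rnorm (0 : V) = 0.
Proof. by rewrite /rnorm normr0. Qed.

Lemma rnorm_eq0 x : rnorm x = 0 -> x = 0.
Proof. by move=> x0; apply/normr0_eq0; rewrite -rnormE x0. Qed.

Lemma rnormD x y : rnorm (x + y) <= rnorm x + rnorm y.
Proof. by rewrite -lecR rmorphD /= !rnormE; exact: ler_normD. Qed.

Lemma rnormZ a x : rnorm (a *: x) = rnorm (a : R[i]^o) * rnorm x.
Proof.
by apply: complexI; rewrite rmorphM /= !rnormE normrZ.
Qed.

End RealNorm.

Section SupNorm.
Context {R : realType} {U V : normedModType R[i]}.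
Implicit Types (f g : U -> V) (x : U).

Definition unit_ball : set U := [set x | rnorm x <= 1].

Definition bounded_on_ball f := exists M : R, forall x, unit_ball x -> rnorm (f x) <= M.

Definition sup_norm f : R := sup [set rnorm (f x) | x in unit_ball].

Lemma unit_ball0 : unit_ball 0.
Proof. by rewrite /unit_ball /= rnorm0. Qed.

Lemma sup_norm_ub f x : bounded_on_ball f -> unit_ball x -> rnorm (f x) <= sup_norm f.
Proof.
move=> [M fM] Bx; apply: ub_le_sup; last by exists x.
by exists M => _ [y By <-]; exact: fM.
Qed.

Lemma sup_norm_le f M : (forall x, unit_ball x -> rnorm (f x) <= M) -> sup_norm f <= M.
Proof.
move=> fM; apply: ge_sup; first by exists (rnorm (f 0)); exists 0 => //; exact: unit_ball0.
by move=> _ [y By <-]; exact: fM.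
Qed.

Lemma sup_norm_ge0 f : bounded_on_ball f -> 0 <= sup_norm f.
Proof. by move=> bf; apply: le_trans (sup_norm_ub bf unit_ball0); exact: rnorm_ge0. Qed.

Lemma bounded_on_ballP a f g : bounded_on_ball f -> bounded_on_ball g ->
  bounded_on_ball (a *: f + g).
Proof.
move=> bf bg; exists (rnorm (a : R[i]^o) * sup_norm f + sup_norm g) => x Bx.
apply: (le_trans (rnormD _ _)); rewrite rnormZ lerD ?sup_norm_ub//.
by rewrite ler_wpM2l ?rnorm_ge0 ?sup_norm_ub.
Qed.

Lemma sup_normD f g : bounded_on_ball f -> bounded_on_ball g ->
  sup_norm (f + g) <= sup_norm f + sup_norm g.
Proof.
move=> bf bg; apply: sup_norm_le => x Bx.
by apply: (le_trans (rnormD _ _)); rewrite lerD ?sup_norm_ub.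
Qed.

Lemma bounded_on_ball0 : bounded_on_ball 0.
Proof. by exists 0 => x _; rewrite rnorm0. Qed.

Let sup_normZ_le a f : bounded_on_ball f ->
  sup_norm (a *: f) <= rnorm (a : R[i]^o) * sup_norm f.
Proof.
move=> bf; apply: sup_norm_le => x Bx.
by rewrite rnormZ ler_wpM2l ?rnorm_ge0 ?sup_norm_ub.
Qed.

Lemma sup_norm0 : sup_norm 0 = 0.
Proof.
apply/eqP; rewrite eq_le sup_norm_ge0 ?andbT; last exact: bounded_on_ball0.
by apply: sup_norm_le => x _; rewrite rnorm0.
Qed.

Lemma sup_normZ a f : bounded_on_ball f ->
  sup_norm (a *: f) = rnorm (a : R[i]^o) * sup_norm f.
Proof.
move=> bf; have [->|a0] := eqVneq a 0.
  by rewrite scale0r sup_norm0 rnorm0 mul0r.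
have baf : bounded_on_ball (a *: f).
  by rewrite -[_ *: _]addr0; apply: bounded_on_ballP => //; exact: bounded_on_ball0.
apply/eqP; rewrite eq_le sup_normZ_le//=.
have a'0 : rnorm (a : R[i]^o) != 0 by apply: contra_neq a0; exact: rnorm_eq0.
have := sup_normZ_le a^-1 baf; rewrite scalerA mulVf// scale1r.
rewrite -(ler_pM2l (_ : 0 < rnorm (a : R[i]^o))); last by rewrite lt_neqAle eq_sym a'0 rnorm_ge0.
move=> h; apply: (le_trans h); rewrite mulrA.
suff -> : rnorm (a : R[i]^o) * rnorm (a^-1 : R[i]^o) = 1 by rewrite mul1r.
by apply: complexI; rewrite rmorphM /= !rnormE -normrM mulfV// normr1.
Qed.

Lemma sup_norm_eq0 f x : bounded_on_ball f -> sup_norm f = 0 -> unit_ball x -> f x = 0.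
Proof.
move=> bf f0 Bx; apply: rnorm_eq0; apply/eqP.
by rewrite eq_le rnorm_ge0 andbT -f0 sup_norm_ub.
Qed.

End SupNorm.

Section Dual.
Context {R : realType}.

Definition cont_linear (X : normedModType R[i]) : {pred (X -> R[i]^o)} :=
  mem [set f : X -> R[i]^o | linear f /\ continuous f].

Arguments cont_linear X : clear implicits.

Record dual (X : normedModType R[i]) := Dual {
  dual_fun :> X -> R[i]^o ;
  dual_funP : dual_fun \in cont_linear X }.

Context {X : normedModType R[i]}.

HB.instance Definition _ := [isSub of dual X for @dual_fun X].
HB.instance Definition _ := [Choice of dual X by <:].

Lemma cont_linear_submod_closed : submod_closed (cont_linear X).
Proof.
split=> [|a f g /set_mem[lf cf] /set_mem[lg cg]]; apply: mem_set.
  split=> [b x y|]; last exact: cst_continuous.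
  by rewrite -[LHS]/(0 : R[i]^o) -[RHS]/(b *: (0 : R[i]^o) + 0) scaler0 addr0.
split=> [b x y|x].
  rewrite -[LHS]/(a *: f _ + g _) -[RHS]/(b *: (a *: f x + g x) + (a *: f y + g y)).
  rewrite lf lg !scalerDr !scalerA [a * b]mulrC -!addrA.
  by congr (_ + _); rewrite addrCA.
by apply: cvgD; [apply: cvgZr; exact: cf|exact: cg].
Qed.

HB.instance Definition _ :=
  GRing.isSubmodClosed.Build R[i] (X -> R[i]^o) (cont_linear X)
    cont_linear_submod_closed.
HB.instance Definition _ := [SubChoice_isSubLmodule of dual X by <:].

Lemma dual_linear (phi : dual X) : linear phi.
Proof. by have := dual_funP phi; rewrite inE => -[]. Qed.

Lemma dual_continuous (phi : dual X) : continuous phi.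
Proof. by have := dual_funP phi; rewrite inE => -[]. Qed.

Lemma dual_bounded (phi : dual X) : bounded_on_ball phi.
Proof.
pose L : {linear X -> R[i]^o} :=
  HB.pack (dual_fun phi) (GRing.isLinear.Build _ _ _ _ _ (dual_linear phi)).
have /linear_boundedP : bounded_near L (nbhs 0).
  by apply: continuous_linear_bounded; exact: (@dual_continuous phi).
move=> /pinfty_ex_gt0[M M0 LM]; exists (complex.Re M) => x x1.
rewrite -lecR rnormE RRe_real; last exact: gtr0_real.
apply: (le_trans (LM x)); rewrite -[leRHS]mulr1 ler_wpM2l ?(ltW M0)//.
by rewrite -rnormE -[1]/(1%:C) lecR.
Qed.

Let dual_norm (phi : dual X) : R[i] := (sup_norm phi)%:C.

Let dual_normD (phi psi : dual X) :
  dual_norm (phi + psi) <= dual_norm phi + dual_norm psi.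
Proof. by rewrite /dual_norm -rmorphD lecR; apply: sup_normD; exact: dual_bounded. Qed.

Let dual_normZ (a : R[i]) (phi : dual X) :
  dual_norm (a *: phi) = `|a| * dual_norm phi.
Proof.
rewrite /dual_norm (_ : `|a| = (rnorm (a : R[i]^o))%:C) ?rnormE// -rmorphM.
by congr (_%:C); apply: sup_normZ; exact: dual_bounded.
Qed.

Let dual_norm_eq0 (phi : dual X) : dual_norm phi = 0 -> phi = 0.
Proof.
move=> /complexI phi0; apply/val_inj/funext => x /=.
have [->|x0] := eqVneq x 0.
  by have := dual_linear phi 1 0 0; rewrite scaler0 addr0 scale1r => /eqP;
     rewrite -subr_eq0 opprD addrA subrr add0r oppr_eq0 => /eqP.
have x'0 : `|x| != 0 by rewrite normr_eq0.
have := dual_linear phi `|x|^-1 x 0; rewrite addr0.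
rewrite (_ : phi 0 = 0) ?addr0; last first.
  by apply: (sup_norm_eq0 (dual_bounded phi)) => //; exact: unit_ball0.
rewrite (sup_norm_eq0 (dual_bounded phi) phi0); last first.
  by rewrite /unit_ball/= -lecR rnormE normrZ normfV normr_id mulVf.
move=> /esym/eqP; rewrite scaler_eq0 invr_eq0 (negbTE x'0)/=.
by move=> /eqP.
Qed.

HB.instance Definition _ := Lmodule_isNormed.Build R[i] (dual X)
  dual_normD dual_normZ dual_norm_eq0.

Lemma dual_rnormE (phi : dual X) : rnorm phi = sup_norm phi.
Proof. by []. Qed.

(* the topology of pointwise convergence on X is the weak-* topology *)
Definition weak_star (phi : dual X) : {ptws X -> R[i]^o} := dual_fun phi.

End Dual.

Variant ball_class := Ab | Au | Awu.

Section BallAlgebra.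
Context {R : realType}.

Definition open_unit_ball (X : normedModType R[i]) : set X := [set x | rnorm x < 1].

(* [differentiable] is Frechet differentiability over R[i] *)
Definition holomorphic_on_ball (X : normedModType R[i]) (f : X -> X) : Prop :=
  forall x, open_unit_ball x -> differentiable f x.

Definition unif_cont_on_ball (X : normedModType R[i]) (f : X -> X) : Prop :=
  forall e : R, 0 < e -> exists2 d : R, 0 < d &
    forall x y : X, unit_ball x -> unit_ball y ->
      rnorm (x - y) < d -> rnorm (f x - f y) < e.

(* uniform continuity from the weak uniformity of the ball to the norm *)
Definition weakly_unif_cont_on_ball (X : normedModType R[i]) (f : X -> X) : Prop :=
  forall e : R, 0 < e -> exists s : seq (dual X), exists2 d : R, 0 < d &
    forall x y : X, unit_ball x -> unit_ball y ->
      (forall phi, phi \in s -> rnorm (phi (x - y)) < d) -> rnorm (f x - f y) < e.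

(* A function on the closed unit ball is encoded by its extension by 0 to X, so
   that Leibniz equality is equality on the ball. *)
Definition ball_fun_pred (X : normedModType R[i]) (k : ball_class) : {pred (X -> X)} :=
  mem [set f : X -> X |
    [/\ forall x, ~ unit_ball x -> f x = 0,
        bounded_on_ball f,
        {within unit_ball, continuous f},
        holomorphic_on_ball f &
        match k with
        | Ab => True
        | Au => unif_cont_on_ball f
        | Awu => unif_cont_on_ball f /\ weakly_unif_cont_on_ball f
        end]].

Arguments ball_fun_pred X k : clear implicits.

Record ball_algebra (X : normedModType R[i]) (k : ball_class) := BallAlgebra {
  ball_fun :> X -> X ;
  ball_funP : ball_fun \in ball_fun_pred X k }.

Context {X : normedModType R[i]} {k : ball_class}.

HB.instance Definition _ := [isSub of ball_algebra X k for @ball_fun X k].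
HB.instance Definition _ := [Choice of ball_algebra X k by <:].

Let unif_cont_submod :
  unif_cont_on_ball (0 : X -> X) /\ forall a (f g : X -> X),
    unif_cont_on_ball f -> unif_cont_on_ball g -> unif_cont_on_ball (a *: f + g).
Proof.
split=> [e e0|a f g uf ug e e0].
  by exists 1 => // x y _ _ _; rewrite subrr rnorm0.
pose A := rnorm (a : R[i]^o) + 1.
have A0 : 0 < A by rewrite ltr_wpDl// rnorm_ge0.
have [|d d0 fd] := uf (e / 2 / A); first by rewrite !divr_gt0.
have [|d' d'0 gd'] := ug (e / 2); first by rewrite divr_gt0.
exists (Num.min d d') => [|x y Bx By]; first by rewrite lt_min d0.
rewrite lt_min => /andP[xyd xyd'].
rewrite -[(a *: f + g) x]/(a *: f x + g x) -[(a *: f + g) y]/(a *: f y + g y).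
rewrite opprD addrACA -scalerBr (le_lt_trans (rnormD _ _))// rnormZ.
rewrite [ltRHS](splitr e) ltr_leD ?ltW ?gd'//.
have fxy := fd _ _ Bx By xyd.
apply: (@le_lt_trans _ _ (rnorm (a : R[i]^o) * (e / 2 / A))).
  by rewrite ler_wpM2l ?rnorm_ge0// ltW.
rewrite mulrCA gtr_pMr ?divr_gt0// ltr_pdivrMr// mul1r.
by rewrite /A ltrDl.
Qed.

Let weakly_unif_cont_submod :
  weakly_unif_cont_on_ball (0 : X -> X) /\ forall a (f g : X -> X),
    weakly_unif_cont_on_ball f -> weakly_unif_cont_on_ball g ->
    weakly_unif_cont_on_ball (a *: f + g).
Proof.
split=> [e e0|a f g uf ug e e0].
  by exists [::], 1 => // x y _ _ _; rewrite subrr rnorm0.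
pose A := rnorm (a : R[i]^o) + 1.
have A0 : 0 < A by rewrite ltr_wpDl// rnorm_ge0.
have [|s [d d0 fd]] := uf (e / 2 / A); first by rewrite !divr_gt0.
have [|s' [d' d'0 gd']] := ug (e / 2); first by rewrite divr_gt0.
exists (s ++ s'), (Num.min d d') => [|x y Bx By xyd]; first by rewrite lt_min d0.
have fxy : rnorm (f x - f y) < e / 2 / A.
  apply: fd => // phi sphi; have := xyd phi; rewrite mem_cat sphi => /(_ isT).
  by rewrite lt_min => /andP[].
have gxy : rnorm (g x - g y) < e / 2.
  apply: gd' => // phi sphi; have := xyd phi; rewrite mem_cat sphi orbT => /(_ isT).
  by rewrite lt_min => /andP[].
rewrite -[(a *: f + g) x]/(a *: f x + g x) -[(a *: f + g) y]/(a *: f y + g y).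
rewrite opprD addrACA -scalerBr (le_lt_trans (rnormD _ _))// rnormZ.
rewrite [ltRHS](splitr e) ltr_leD ?ltW//.
apply: (@le_lt_trans _ _ (rnorm (a : R[i]^o) * (e / 2 / A))).
  by rewrite ler_wpM2l ?rnorm_ge0// ltW.
rewrite mulrCA gtr_pMr ?divr_gt0// ltr_pdivrMr// mul1r.
by rewrite /A ltrDl.
Qed.

Lemma ball_fun_submod_closed : submod_closed (ball_fun_pred X k).
Proof.
have [u0 uD] := unif_cont_submod; have [w0 wD] := weakly_unif_cont_submod.
split=> [|a f g]; rewrite !inE /=.
  split; [by []|exact: bounded_on_ball0|exact: cst_continuous| |by case: k].
  by move=> x _; exact: differentiable_cst.
move=> [f0 bf cf hf kf] [g0 bg cg hg kg]; split.
- by move=> x xB; rewrite -[LHS]/(a *: f x + g x) f0// g0// scaler0 addr0.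
- exact: bounded_on_ballP.
- by move=> x; apply: cvgD; [apply: cvgZr; exact: cf|exact: cg].
- move=> x xB; apply: differentiableD; last exact: hg.
  by apply: differentiableZ; exact: hf.
- case: k kf kg => // [|[? ?] [? ?]]; first exact: uD.
  by split; [exact: uD|exact: wD].
Qed.

HB.instance Definition _ :=
  GRing.isSubmodClosed.Build R[i] (X -> X) (ball_fun_pred X k)
    ball_fun_submod_closed.
HB.instance Definition _ := [SubChoice_isSubLmodule of ball_algebra X k by <:].

Lemma ball_bounded (f : ball_algebra X k) : bounded_on_ball f.
Proof. by have := ball_funP f; rewrite inE => -[]. Qed.

Let ball_norm (f : ball_algebra X k) : R[i] := (sup_norm f)%:C.

Let ball_normD (f g : ball_algebra X k) :
  ball_norm (f + g) <= ball_norm f + ball_norm g.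
Proof. by rewrite /ball_norm -rmorphD lecR; apply: sup_normD; exact: ball_bounded. Qed.

Let ball_normZ (a : R[i]) (f : ball_algebra X k) :
  ball_norm (a *: f) = `|a| * ball_norm f.
Proof.
rewrite /ball_norm (_ : `|a| = (rnorm (a : R[i]^o))%:C) ?rnormE// -rmorphM.
by congr (_%:C); apply: sup_normZ; exact: ball_bounded.
Qed.

Let ball_norm_eq0 (f : ball_algebra X k) : ball_norm f = 0 -> f = 0.
Proof.
move=> /complexI f0; apply/val_inj/funext => x /=.
have [Bx|Bx] := pselect (unit_ball x).
  exact: (sup_norm_eq0 (ball_bounded f) f0).
by have := ball_funP f; rewrite inE => -[-> ].
Qed.

HB.instance Definition _ := Lmodule_isNormed.Build R[i] (ball_algebra X k)
  ball_normD ball_normZ ball_norm_eq0.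

Lemma ball_rnormE (f : ball_algebra X k) : rnorm f = sup_norm f.
Proof. by []. Qed.

End BallAlgebra.

Section Peaks.
Context {R : realType} {X : normedModType R[i]} {k : ball_class}.
Implicit Types (f : ball_algebra X k) (t : X) (z : X * dual X).

Definition duality_pairs : set (X * dual X) :=
  [set z : X * dual X | [/\ rnorm z.1 = 1, rnorm z.2 = 1 & z.2 z.1 = 1]].

Definition pairing (f : X -> X) z : R := rnorm (z.2 (f z.1)).

Definition numerical_radius (f : X -> X) : R :=
  sup [set pairing f z | z in duality_pairs].

Definition norm_strong_peak_at f t : Prop :=
  [/\ unit_ball t,
      rnorm (f t) = rnorm f,
      forall s, unit_ball s -> rnorm (f s) = rnorm f -> s = t &
      forall t_ : nat -> X, (forall n, unit_ball (t_ n)) ->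
        rnorm (f (t_ n)) @[n --> \oo] --> rnorm f -> t_ @ \oo --> t].

Definition norm_strong_peak f : Prop := exists t, norm_strong_peak_at f t.

(* convergence for the product of the norm topology and the weak-* topology *)
Definition tau_cvg (z_ : nat -> X * dual X) z : Prop :=
  ((z_ n).1, weak_star (z_ n).2) @[n --> \oo] --> (z.1, weak_star z.2).

Definition numerical_strong_peak_at f z : Prop :=
  [/\ duality_pairs z,
      pairing f z = numerical_radius f,
      forall w, duality_pairs w -> pairing f w = numerical_radius f -> w = z &
      forall z_ : nat -> X * dual X, (forall n, duality_pairs (z_ n)) ->
        pairing f (z_ n) @[n --> \oo] --> numerical_radius f -> tau_cvg z_ z].

Definition numerical_strong_peak f : Prop :=
  exists z, numerical_strong_peak_at f z.

Definition very_strong_numerical_peak_at f z : Prop :=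
  numerical_strong_peak_at f z /\
  forall z_ : nat -> X * dual X, (forall n, duality_pairs (z_ n)) ->
    pairing f (z_ n) @[n --> \oo] --> numerical_radius f ->
    (z_ n).1 @[n --> \oo] --> z.1 /\ (z_ n).2 @[n --> \oo] --> z.2.

Definition very_strong_numerical_peak f : Prop :=
  exists z, very_strong_numerical_peak_at f z.

End Peaks.

Section ComplexLp.
Context d (T : measurableType d) {R : realType}.
Variables (mu : {measure set T -> \bar R}) (p : R).

(* The unused argument p1 makes the vector space structure, which rests on
   Minkowski's inequality, inferable from the type. *)
Definition cLfun_pred (p1 : 1 <= p) : {pred (T -> R[i]^o)} :=
  mem [set f : T -> R[i]^o |
    [/\ measurable_fun [set: T] (fun x => complex.Re (f x)),
        measurable_fun [set: T] (fun x => complex.Im (f x)) &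
        finite_norm mu p%:E (fun x => rnorm (f x))]].

Record cLfun (p1 : 1 <= p) := CLfun {
  cLfun_fun :> T -> R[i]^o ;
  cLfun_funP : cLfun_fun \in cLfun_pred p1 }.

Variable p1 : 1 <= p.

HB.instance Definition _ := [isSub of cLfun p1 for @cLfun_fun p1].
HB.instance Definition _ := [Choice of cLfun p1 by <:].

Let p0 : 0 < p. Proof. exact: lt_le_trans p1. Qed.

Let measurable_rnorm (f : T -> R[i]^o) :
  measurable_fun [set: T] (fun x => complex.Re (f x)) ->
  measurable_fun [set: T] (fun x => complex.Im (f x)) ->
  measurable_fun [set: T] (fun x => rnorm (f x)).
Proof.
move=> mr mi.
rewrite (_ : (fun x => rnorm (f x)) =
  (@powR R ^~ 2^-1) \o (fun x => complex.Re (f x) ^+ 2 + complex.Im (f x) ^+ 2)).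
  apply: measurableT_comp; first exact: measurable_powR.
  by apply: measurable_funD; apply: measurable_funX.
by apply/funext => x /=; rewrite powR12_sqrt ?addr_ge0 ?sqr_ge0// /rnorm normc_def.
Qed.

Let le_Lnorm (f g : T -> R) : measurable_fun [set: T] f -> measurable_fun [set: T] g ->
  (forall x, 0 <= f x <= g x) -> ('N[mu]_p%:E[EFin \o f] <= 'N[mu]_p%:E[EFin \o g])%E.
Proof.
move=> mf mg fg; rewrite unlock /Lnorm.
apply: gt0_ler_poweR; rewrite ?invr_ge0 ?(ltW p0)// ?in_itv/= ?leey ?andbT.
- by apply: integral_ge0 => x _; rewrite lee_fin powR_ge0.
- by apply: integral_ge0 => x _; rewrite lee_fin powR_ge0.
- apply: ge0_le_integral => //.
  + apply/measurable_EFinP; apply: (measurableT_comp (measurable_powR _)).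
    exact: measurableT_comp.
  + apply/measurable_EFinP; apply: (measurableT_comp (measurable_powR _)).
    exact: measurableT_comp.
  + move=> x _ /=; rewrite lee_fin ge0_ler_powR ?nnegrE ?(ltW p0)//.
    by have /andP[f0 fgx] := fg x; rewrite !ger0_norm// (le_trans f0).
Qed.

Let cLnorm (f : T -> R[i]^o) : \bar R := 'N[mu]_p%:E[EFin \o (fun x => rnorm (f x))].

Let cLnormZ (a : R[i]) (f : T -> R[i]^o) : f \in cLfun_pred p1 ->
  cLnorm (a *: f) = ((rnorm (a : R[i]^o))%:E * cLnorm f)%E.
Proof.
rewrite inE /= => -[mr mi fp].
have fL : (fun x => rnorm (f x)) \in Lfun mu p%:E.
  by rewrite inE; apply/andP; split; rewrite inE//; exact: measurable_rnorm.
have p1E : (1 <= p%:E)%E by rewrite lee_fin.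
have := LnormZ (Lfun_Sub p1E fL) (rnorm (a : R[i]^o)).
rewrite ger0_norm ?rnorm_ge0// => <-.
congr Lnorm; apply/funext => x /=; congr EFin.
exact: rnormZ.
Qed.

Let cLnormD (f g : T -> R[i]^o) : f \in cLfun_pred p1 -> g \in cLfun_pred p1 ->
  (cLnorm (f + g)%R <= cLnorm f + cLnorm g)%E.
Proof.
rewrite !inE /= => -[mr mi fp] [mr' mi' gp].
have mf := measurable_rnorm mr mi; have mg := measurable_rnorm mr' mi'.
apply: le_trans (minkowski_EFin mu mf mg p1).
apply: le_Lnorm => //; last by move=> x; rewrite rnorm_ge0 rnormD.
- apply: measurable_rnorm.
  + rewrite (_ : (fun _ => _) = (fun x => complex.Re (f x) + complex.Re (g x))).
      exact: measurable_funD.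
    by apply/funext => x; rewrite -[(f + g) x]/(f x + g x); case: (f x) (g x) => ? ? [].
  + rewrite (_ : (fun _ => _) = (fun x => complex.Im (f x) + complex.Im (g x))).
      exact: measurable_funD.
    by apply/funext => x; rewrite -[(f + g) x]/(f x + g x); case: (f x) (g x) => ? ? [].
- exact: measurable_funD.
Qed.

Lemma cLfun_submod_closed : submod_closed (cLfun_pred p1).
Proof.
have L0 : (0 : T -> R[i]^o) \in cLfun_pred p1.
  rewrite inE /=; split; [exact: measurable_cst|exact: measurable_cst|].
  rewrite (_ : (fun _ => _) = cst 0); last by apply/funext => x; exact: rnorm0.
  by rewrite /finite_norm Lnorm0// eqe gt_eqF.
split=> // a f g Lf Lg.
have Laf : a *: f \in cLfun_pred p1.
  move: (Lf); rewrite !inE /= => -[mr mi fp]; split.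
  - rewrite (_ : (fun _ => _) = (fun x => complex.Re a * complex.Re (f x) -
        complex.Im a * complex.Im (f x))).
      by apply: measurable_funB; apply: measurable_funM.
    by apply/funext => x; rewrite -[(a *: f) x]/(a * f x); case: a (f x) => ? ? [].
  - rewrite (_ : (fun _ => _) = (fun x => complex.Re a * complex.Im (f x) +
        complex.Im a * complex.Re (f x))).
      by apply: measurable_funD; apply: measurable_funM.
    by apply/funext => x; rewrite -[(a *: f) x]/(a * f x); case: a (f x) => ? ? [].
  - rewrite /finite_norm -/(cLnorm (a *: f)) cLnormZ// lte_mul_pinfty//.
    by rewrite lee_fin rnorm_ge0.
move: (Laf) (Lg); rewrite !inE /= => -[mr mi fp] [mr' mi' gp]; split.
- rewrite (_ : (fun _ => _) = (fun x => complex.Re ((a *: f) x) + complex.Re (g x))).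
    exact: measurable_funD.
  by apply/funext => x; rewrite -[(a *: f + g) x]/((a *: f) x + g x);
    case: ((a *: f) x) (g x) => ? ? [].
- rewrite (_ : (fun _ => _) = (fun x => complex.Im ((a *: f) x) + complex.Im (g x))).
    exact: measurable_funD.
  by apply/funext => x; rewrite -[(a *: f + g) x]/((a *: f) x + g x);
    case: ((a *: f) x) (g x) => ? ? [].
- by apply: (le_lt_trans (cLnormD Laf Lg)); rewrite lte_add_pinfty.
Qed.


HB.instance Definition _ :=
  GRing.isSubmodClosed.Build R[i] (T -> R[i]^o) (cLfun_pred p1) cLfun_submod_closed.
HB.instance Definition _ := [SubChoice_isSubLmodule of cLfun p1 by <:].

Definition cLfun_null : {pred cLfun p1} :=
  mem [set f : cLfun p1 | {ae mu, forall x, f x = 0}].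

Lemma cLfun_null_zmod_closed : zmod_closed cLfun_null.
Proof.
split=> [|f g]; rewrite !inE /=; first exact: aeW.
by apply: filterS2 => x fx gx; rewrite -[LHS]/(f x - g x) fx gx subr0.
Qed.

HB.instance Definition _ :=
  GRing.isZmodClosed.Build (cLfun p1) cLfun_null cLfun_null_zmod_closed.

(* L_p(mu) over R[i]: classes of functions modulo equality mu-a.e. *)
Definition cLspace : Type := {ideal_quot cLfun_null}.
HB.instance Definition _ := GRing.Zmodule.on cLspace.
HB.instance Definition _ := EqQuotient.on cLspace.

Local Open Scope quotient_scope.

Lemma cLspace_eqP (f g : cLfun p1) :
  (\pi_cLspace f = \pi_cLspace g) <-> {ae mu, forall x, f x = g x}.
Proof.
have -> : (\pi_cLspace f = \pi_cLspace g) <-> f - g \in cLfun_null.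
  by rewrite ring_quotient.Quotient.idealrBE; split=> [fg|/eqP//]; apply/eqP.
rewrite inE /=; split; apply: filterS => x.
  by move=> /(fun h : f x - g x = 0 => h)/eqP; rewrite subr_eq0 => /eqP.
by move=> fg; suff : f x - g x = 0 by []; rewrite fg subrr.
Qed.

Let repr_pi_ae (f : cLfun p1) : {ae mu, forall x, repr (\pi_cLspace f) x = f x}.
Proof. by apply/cLspace_eqP; rewrite reprK. Qed.

Let repr_ae_D (x y : cLspace) :
  {ae mu, forall t, repr (x + y) t = repr x t + repr y t}.
Proof.
suff -> : x + y = \pi_cLspace (repr x + repr y) by exact: repr_pi_ae.
by rewrite raddfD /= !reprK.
Qed.

Definition cLspace_scale (a : R[i]) (x : cLspace) : cLspace :=
  \pi_cLspace (a *: repr x).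

Let cLspace_scaleE a (f : cLfun p1) :
  cLspace_scale a (\pi_cLspace f) = \pi_cLspace (a *: f).
Proof.
apply/cLspace_eqP; have := repr_pi_ae f; apply: filterS => t ft.
by rewrite -[LHS]/(a *: repr (\pi_cLspace f) t) ft.
Qed.

Let cLspace_scaleA a b (x : cLspace) :
  cLspace_scale a (cLspace_scale b x) = cLspace_scale (a * b) x.
Proof.
by rewrite -[x]reprK (cLspace_scaleE b) (cLspace_scaleE a) (cLspace_scaleE (a * b)) scalerA.
Qed.

Let cLspace_scale1 : left_id 1 cLspace_scale.
Proof. by move=> x; rewrite -[x]reprK !cLspace_scaleE scale1r. Qed.

Let cLspace_scaleDr : right_distributive cLspace_scale +%R.
Proof.
move=> a x y; rewrite -[x]reprK -[y]reprK -raddfD /= !cLspace_scaleE.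
by rewrite scalerDr raddfD.
Qed.

Let cLspace_scaleDl (x : cLspace) :
  {morph cLspace_scale^~ x : a b / a + b}.
Proof. by move=> a b /=; rewrite -[x]reprK !cLspace_scaleE scalerDl raddfD. Qed.

HB.instance Definition _ := GRing.Zmodule_isLmodule.Build R[i] cLspace
  cLspace_scaleA cLspace_scale1 cLspace_scaleDr cLspace_scaleDl.

Let Lp_norm (x : cLspace) : R[i] := (fine (cLnorm (repr x)))%:C.

Let cLnorm_fin (f : cLfun p1) : (fine (cLnorm f))%:E = cLnorm f.
Proof.
have := cLfun_funP f; rewrite inE /= => -[_ _ fp].
by rewrite fineK// ge0_fin_numE// Lnorm_ge0.
Qed.

Let cLnorm_ae (f g : cLfun p1) : {ae mu, forall x, f x = g x} ->
  cLnorm f = cLnorm g.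
Proof.
move=> fg; have := cLfun_funP f; have := cLfun_funP g.
rewrite !inE /= => -[mgr mgi _] [mfr mfi _].
have mf := measurable_rnorm mfr mfi; have mg := measurable_rnorm mgr mgi.
rewrite /cLnorm unlock /Lnorm; congr poweR.
apply: ae_eq_integral => //.
- apply/measurable_EFinP; apply: (measurableT_comp (measurable_powR _)).
  exact: measurableT_comp.
- apply/measurable_EFinP; apply: (measurableT_comp (measurable_powR _)).
  exact: measurableT_comp.
- by apply: filterS fg => x /= -> _.
Qed.

Let Lp_normE (f : cLfun p1) : Lp_norm (\pi_cLspace f) = (fine (cLnorm f))%:C.
Proof. by rewrite /Lp_norm (cLnorm_ae (repr_pi_ae f)). Qed.

Let Lp_normD (x y : cLspace) : Lp_norm (x + y) <= Lp_norm x + Lp_norm y.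
Proof.
rewrite -[x]reprK -[y]reprK -raddfD /= !Lp_normE -rmorphD lecR.
rewrite -lee_fin EFinD !cLnorm_fin; apply: cLnormD; exact: cLfun_funP.
Qed.

Let Lp_normZ (a : R[i]) (x : cLspace) : Lp_norm (a *: x) = `|a| * Lp_norm x.
Proof.
rewrite -[x]reprK -[_ *: _]/(cLspace_scale _ _) cLspace_scaleE !Lp_normE.
rewrite (_ : `|a| = (rnorm (a : R[i]^o))%:C) ?rnormE// -rmorphM; congr (_%:C).
by apply: EFin_inj; rewrite cLnorm_fin EFinM cLnorm_fin cLnormZ//; exact: cLfun_funP.
Qed.

Let Lp_norm_eq0 (x : cLspace) : Lp_norm x = 0 -> x = 0.
Proof.
rewrite -[x]reprK Lp_normE => /complexI x0.
rewrite -(raddf0 \pi_cLspace); apply/cLspace_eqP.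
have := cLfun_funP (repr x); rewrite inE /= => -[mr mi _].
have mx := measurable_rnorm mr mi.
have : cLnorm (repr x) = 0%E by rewrite -cLnorm_fin x0.
move=> /Lnorm_eq0_eq0.
have /measurable_EFinP : measurable_fun [set: T] (fun t => rnorm (repr x t)) by [].
move=> /[swap] /[apply]; rewrite lte_fin => /(_ p0).
by apply: filterS => t /(_ I) [] /rnorm_eq0.
Qed.

HB.instance Definition _ := Lmodule_isNormed.Build R[i] cLspace
  Lp_normD Lp_normZ Lp_norm_eq0.

Lemma cLspace_rnormE (x : cLspace) :
  rnorm x = fine ('N[mu]_p%:E[EFin \o (fun t => rnorm (repr x t))]).
Proof. by []. Qed.

End ComplexLp.

(* Main.v *)
From HB Require Import structures.
Require Import Defs.
From mathcomp Require Import all_boot all_order all_algebra.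
From mathcomp Require Import all_classical all_reals all_analysis.
From mathcomp Require Import ring lra measurable_realfun borel_hierarchy complex.

(* The proof is a Baire category argument in which all perturbations are affine
   maps x |-> (c + psi x) y.  Such maps lie in each of the three ball algebras,
   and so do their uniform limits, so neither completeness of the algebra nor any
   complex analysis is needed.

   A function strongly peaks if and only if, for every n, some slice of
   near-maximizers has diameter < 1/n, which is an open condition.  For the
   numerical radius the slices only have to control the point x, because uniform
   smoothness makes the duality map x |-> x^* uniformly continuous from norm to
   norm.  This also gives the last claim.

   Density for the numerical radius: if (x1, x1^* ) nearly attains v(f), add a
   small multiple of (1 + x1^*(x)) x1 / 2.
   Density for the norm, where the near-maximizer may be an interior point of the
   ball: first add a small constant vector t w, with w in the direction of a
   near-maximal value of f, so that functionals norming values close to the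
   maximum nearly norm w; hence adding s psi(x) w changes the norm of such values
   by about s Re psi(x).  Then take for psi the gradient of ||.||^p at a
   near-maximizer x1 of ||f(x) + t w|| + s ||x||^p.

   For L_p, uniform convexity is a pointwise inequality for complex numbers that
   is integrated, and uniform smoothness follows in the same way from the
   pointwise inequality for the conjugate exponent. *)

Set Implicit Arguments.
Unset Strict Implicit.
Unset Printing Implicit Defensive.

Import Order.TTheory GRing.Theory Num.Theory.
Import numFieldNormedType.Exports.

Local Open Scope classical_set_scope.
Local Open Scope ring_scope.
Local Open Scope complex_scope.

(** * Real-valued norms and a relative Baire argument *)

Section RealNormTheory.
Context {R : realType}.

Lemma rnormr (V : normedModType R[i]) (x : V) : `|x| = (rnorm x)%:C.
Proof. by rewrite rnormE. Qed.

Lemma rnorm_real (r : R) : rnorm (r%:C : R[i]^o) = `|r|.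
Proof. by rewrite /rnorm normc_def /= expr0n addr0 sqrtr_sqr. Qed.

Lemma Re_le_rnorm (a : R[i]) : complex.Re a <= rnorm (a : R[i]^o).
Proof.
apply: (le_trans (ler_norm _)); rewrite -lecR rnormE; exact: normc_ge_Re.
Qed.

Lemma sqr_rnorm (a : R[i]) :
  rnorm (a : R[i]^o) ^+ 2 = complex.Re a ^+ 2 + complex.Im a ^+ 2.
Proof. by apply: complexI; rewrite rmorphXn /= rnormE add_Re2_Im2. Qed.

Lemma rnormM (a b : R[i]) :
  rnorm (a * b : R[i]^o) = rnorm (a : R[i]^o) * rnorm (b : R[i]^o).
Proof. exact: (@rnormZ _ (R[i]^o)). Qed.

Lemma Re_scale (r : R) (a : R[i]) : complex.Re (r%:C * a) = r * complex.Re a.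
Proof. by case: a => a b /=; rewrite mul0r subr0. Qed.

Lemma rnorm1 : rnorm (1 : R[i]^o) = 1.
Proof. by rewrite (_ : 1 = (1 : R)%:C) // rnorm_real normr1. Qed.

Lemma unit_phase (a : R[i]) : exists c : R[i],
  rnorm (c : R[i]^o) = 1 /\ a = (rnorm (a : R[i]^o))%:C * c.
Proof.
have [->|a0] := eqVneq a 0.
  by exists 1; rewrite rnorm1 rnorm0 mul0r.
have na0 : (rnorm (a : R[i]^o))%:C != 0 by rewrite rnormE normr_eq0.
exists ((rnorm (a : R[i]^o))%:C^-1 * a); split; last by rewrite mulrA mulfV// mul1r.
rewrite -fmorphV rnormM rnorm_real ger0_norm ?invr_ge0 ?rnorm_ge0// mulVf//.
by apply: contra_neq na0 => ->.
Qed.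

Lemma unit_phaseV (a : R[i]) : exists2 c : R[i],
  rnorm (c : R[i]^o) = 1 & c * a = (rnorm (a : R[i]^o))%:C.
Proof.
have [c [c1 ac]] := unit_phase a.
have c0 : c != 0 by apply/eqP => c0; move/eqP: c1; rewrite c0 rnorm0 eq_sym oner_eq0.
exists c^-1; last by rewrite [in LHS]ac mulrCA mulVf// mulr1.
by have := rnormM c^-1 c; rewrite mulVf// c1 rnorm1 mulr1.
Qed.

Context {V : normedModType R[i]}.
Implicit Types (x y z : V).

Lemma rnormN x : rnorm (- x) = rnorm x.
Proof. by rewrite /rnorm normrN. Qed.

Lemma rnormBC x y : rnorm (x - y) = rnorm (y - x).
Proof. by rewrite -rnormN opprB. Qed.

Lemma rnormB x y : rnorm (x - y) <= rnorm x + rnorm y.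
Proof. by rewrite -(rnormN y) rnormD. Qed.

Lemma rnormBD z x y : rnorm (x - y) <= rnorm (x - z) + rnorm (z - y).
Proof. by rewrite (le_trans _ (rnormD _ _))// addrA subrK. Qed.

Lemma rnorm_le_dist x y : rnorm x - rnorm y <= rnorm (x - y).
Proof. by rewrite lerBlDr (le_trans _ (rnormD _ _))// subrK. Qed.

Lemma rnorm_dist x y : `|rnorm x - rnorm y| <= rnorm (x - y).
Proof. by rewrite ler_norml rnorm_le_dist andbT lerNl opprB rnormBC rnorm_le_dist. Qed.

Lemma rnormZr (r : R) x : 0 <= r -> rnorm (r%:C *: x) = r * rnorm x.
Proof. by move=> r0; rewrite rnormZ rnorm_real ger0_norm. Qed.

Lemma rnorm_gt0 x : x != 0 -> 0 < rnorm x.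
Proof.
by move=> x0; rewrite lt_neqAle rnorm_ge0 andbT eq_sym; apply: contra_neq x0; exact: rnorm_eq0.
Qed.

Lemma ltc_real (e : R[i]) : 0 < e -> exists2 r : R, 0 < r & e = r%:C.
Proof.
case: e => a b; rewrite ltcE /= => /andP[/eqP -> a0]; exists a => //.
Qed.

Lemma cvg_rnormP (T : Type) (F : set_system T) (FF : Filter F) (f : T -> V) l :
  f @ F --> l <-> forall e : R, 0 < e -> \forall t \near F, rnorm (l - f t) < e.
Proof.
rewrite cvgrPdist_lt; split=> [h e e0|h e /ltc_real[r r0 ->]].
  have := h e%:C; rewrite ltcR => /(_ e0); apply: filterS => t.
  by rewrite rnormr ltcR.
by have := h r r0; apply: filterS => t; rewrite rnormr ltcR.
Qed.

Lemma cvg_seqP (u : nat -> V) l : u @ \oo --> l <->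
  forall e : R, 0 < e -> exists N, forall n, (N <= n)%N -> rnorm (u n - l) < e.
Proof.
rewrite cvg_rnormP; split=> h e e0.
  have [N _ hN] := h e e0; exists N => n Nn; rewrite rnormBC; exact: hN.
by have [N hN] := h e e0; exists N => // n /= Nn; rewrite rnormBC; exact: hN.
Qed.

Lemma open_rnormP (A : set V) : open A <->
  forall x, A x -> exists2 r : R, 0 < r & forall y, rnorm (y - x) < r -> A y.
Proof.
rewrite openE; split=> h x Ax.
  have := h x Ax; rewrite /interior -nbhs_ballE => -[e /= /ltc_real[r r0 ->] rA].
  by exists r => // y yx; apply: rA; rewrite -ball_normE /ball_ /= rnormr ltcR rnormBC.
have [r r0 rA] := h x Ax; rewrite /interior -nbhs_ballE; exists r%:C; first by rewrite /= ltcR.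
by move=> y; rewrite -ball_normE /ball_ /= rnormr ltcR rnormBC => /rA.
Qed.

Lemma cvg_rnorm (u : nat -> V) l : u @ \oo --> l -> rnorm (u n) @[n --> \oo] --> rnorm l.
Proof.
move=> /cvg_seqP ul; apply/cvgrPdist_lt => e e0; have [N hN] := ul e e0.
exists N => // n /= Nn; rewrite (le_lt_trans (rnorm_dist _ _))// rnormBC; exact: hN.
Qed.

Lemma rnorm_lim_le (u : nat -> V) l M N : u @ \oo --> l ->
  (forall n, (N <= n)%N -> rnorm (u n) <= M) -> rnorm l <= M.
Proof.
move=> /cvg_seqP ul uM; apply/ler_addgt0Pr => e e0.
have [N' hN'] := ul e e0; have := hN' (maxn N N') (leq_maxr _ _).
have := uM (maxn N N') (leq_maxl _ _).
have := rnorm_le_dist l (u (maxn N N')); rewrite rnormBC; lra.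
Qed.

End RealNormTheory.

Lemma cvg_Rseqn (R : realType) (u : nat -> R) (l : R) : u @ \oo --> l <->
  forall e : R, 0 < e -> exists N, forall n, (N <= n)%N -> `|u n - l| < e.
Proof.
rewrite (@cvgrPdist_lt R R^o); split=> h e e0.
  by have [N _ hN] := h e e0; exists N => n Nn; rewrite distrC; exact: hN.
by have [N hN] := h e e0; exists N => // n /= Nn; rewrite distrC; exact: hN.
Qed.

Lemma cvg_Rseq_unique (R : realType) (u : nat -> R) (l m : R) :
  u @ \oo --> l -> u @ \oo --> m -> l = m.
Proof. exact: (@norm_cvg_unique R R^o). Qed.

Lemma cvg_seq_unique (R : realType) (V : normedModType R[i]) (u : nat -> V) (l m : V) :
  u @ \oo --> l -> u @ \oo --> m -> l = m.
Proof. exact: norm_cvg_unique. Qed.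

Lemma cvg_seq_cst (R : realType) (V : normedModType R[i]) (c l : V) :
  (fun=> c) @ \oo --> l -> c = l.
Proof. by apply: cvg_seq_unique; exact: cvg_cst. Qed.

Definition seq_complete (R : realType) (V : normedModType R[i]) := forall u : nat -> V,
  (forall e : R, 0 < e -> exists N, forall m n, (N <= m)%N -> (N <= n)%N ->
    rnorm (u m - u n) < e) ->
  exists l : V, u @ \oo --> l.

(* Since the Cauchy sequences built in Baire's argument have all their increments
   in [E], completeness is only needed for such sequences. *)
Lemma baire_relative (R : realType) (V : normedModType R[i]) (E : set V)
    (W : nat -> set V) :
  E 0 -> (forall h k, E h -> E k -> E (h + k)) ->
  (forall u : nat -> V,
    (forall e : R, 0 < e -> exists N, forall m n, (N <= m)%N -> (N <= n)%N ->
      rnorm (u m - u n) < e) ->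
    (forall n, E (u n - u 0)) -> exists l : V, u @ \oo --> l) ->
  (forall n, open (W n)) ->
  (forall n f (e : R), 0 < e -> exists h, [/\ E h, rnorm h < e & W n (f + h)]) ->
  dense (\bigcap_n W n).
Proof.
move=> E0 ED Ecvg Wo Wd O [f Of] /open_rnormP Oo.
have [r r0 rO] := Oo f Of.
(* A state is a stage, a centre and a radius. The next centre moves by at most half the radius,
   along an element of [E], and a closed ball around it lies inside the current [W n]. *)
pose T := (nat * V * {e : R | 0 < e})%type.
pose ok (s t : T) := let: (n, a, e) := s in let: (m, b, e') := t in
  [/\ m = n.+1, E (b - a), rnorm (b - a) <= sval e / 2, sval e' <= sval e / 2 &
      forall c, rnorm (c - b) <= sval e' -> W n c].
have step s : {t | ok s t}.
  apply: cid; case: s => [[n a] [e e0]].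
  have [|h [Eh he Wh]] := Wd n a (e / 2); first by rewrite divr_gt0.
  have /open_rnormP/(_ _ Wh)[q q0 qW] := Wo n.
  have m0 : 0 < Num.min (q / 2) (e / 2) by rewrite lt_min !divr_gt0.
  exists (n.+1, a + h, exist (fun e : R => is_true (0 < e)) _ m0); split=> //=.
  - by rewrite addrAC subrr add0r.
  - by rewrite addrAC subrr add0r ltW.
  - by rewrite ge_min lexx orbT.
  - move=> c; rewrite le_min => /andP[cq _]; apply: qW; lra.
have r20 : 0 < r / 2 by rewrite divr_gt0.
have [F [F0 FS]] := dependent_choice step (0, f, exist (fun e : R => is_true (0 < e)) _ r20).
pose u n := (F n).1.2; pose e n : R := sval (F n).2.
have Fn n : (F n).1.1 = n.
  elim: n => [|n IH]; first by rewrite F0.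
  by move: (FS n) IH; case: (F n) => -[m a] q; case: (F n.+1) => -[m' b] q' /= [-> _ _ _ _] ->.
have uS n : [/\ E (u n.+1 - u n), rnorm (u n.+1 - u n) <= e n / 2, e n.+1 <= e n / 2 &
      forall c, rnorm (c - u n.+1) <= e n.+1 -> W n c].
  move: (FS n) (Fn n); rewrite /u /e.
  by case: (F n) => -[m a] q; case: (F n.+1) => -[m' b] q' /= [_ ? ? ? ?] <-.
have epos n : 0 < e n by rewrite /e; case: (F n).2.
(* Telescoping: a move costs at most [e n / 2], and since the radii at least halve,
   [e n / 2 <= e n - e n.+1]. So every later centre, and the limit, stays within [e n] of [u n]. *)
have ud n k : rnorm (u (n + k)%N - u n) <= e n - e (n + k)%N.
  elim: k => [|k IH]; first by rewrite addn0 !subrr rnorm0.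
  rewrite addnS; apply: (le_trans (rnormBD (u (n + k)%N) _ _)).
  have [_ h1 h2 _] := uS (n + k)%N; lra.
have ee n : e n <= r / 2 / 2 ^+ n.
  elim: n => [|n IH]; first by rewrite expr0 divr1 /e F0.
  have [_ _ h _] := uS n; apply: (le_trans h).
  by rewrite exprSr invfM mulrA ler_pM2r// invr_gt0.
have [l /cvg_seqP ul] : exists l : V, u @ \oo --> l.
  apply: Ecvg => [q q0|n].
    have : r / 2 / 2 ^+ n @[n --> \oo] --> (0 : R).
      under eq_fun do rewrite -exprVn.
      by apply: (@cvg_geometric R (r / 2) 2^-1); rewrite ger0_norm ?invr_ge0// invf_lt1 // ltr1n.
    move=> /cvg_Rseqn/(_ (q / 2))[|N hN]; first by rewrite divr_gt0.
    have := hN N (leqnn N); rewrite subr0 => hq.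
    have eN : e N < q / 2 by apply: (le_lt_trans (ee N)); exact: le_lt_trans (ler_norm _) hq.
    exists N => m n Nm Nn; apply: (le_lt_trans (rnormBD (u N) _ _)); rewrite (rnormBC (u N)).
    have := ud N (m - N)%N; have := ud N (n - N)%N; rewrite !subnKC//.
    have := epos m; have := epos n; lra.
  elim: n => [|n IH]; first by rewrite subrr.
  have [h _ _ _] := uS n; have := ED _ _ h IH; by rewrite addrA subrK.
have lu n : rnorm (l - u n) <= e n.
  have /rnorm_lim_le : (fun k => u k - u n) @ \oo --> l - u n.
    apply/cvg_seqP => q q0; have [N hN] := ul q q0; exists N => m Nm.
    by rewrite opprB addrA subrK hN.
  move=> /(_ _ n); apply => k nk.
  by have := ud n (k - n)%N; rewrite subnKC//; have := epos k; lra.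
exists l; split.
  apply: rO; have := lu 0; rewrite /u /e F0 /= => h; lra.
by move=> n _; have [_ _ _ h] := uS n; exact: h.
Qed.

(** * Norming functionals in uniformly smooth spaces *)

Section Duality.
Context {R : realType} {X : normedModType R[i]}.
Implicit Types (x y h v : X) (phi psi : dual X).

Lemma linear_rnorm_continuous (V W : normedModType R[i]) (f : V -> W) (C : R) :
  linear f -> (forall x : V, rnorm (f x) <= C * rnorm x) -> continuous f.
Proof.
move=> lf fC.
pose L : {linear V -> W} := HB.pack f (GRing.isLinear.Build _ _ _ _ _ lf).
have fB (x y : V) : f (x - y) = f x - f y by exact: (raddfB L).
move=> x; apply/cvg_rnormP => e e0.
have C1 : 0 < `|C| + 1 by rewrite ltr_wpDl.
have /(cvg_rnormP _ id) : id @ x --> x by exact: cvg_id.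
move=> /(_ (e / (`|C| + 1))); rewrite divr_gt0// => /(_ isT); apply: filterS => y yx.
rewrite -fB (le_lt_trans (fC _))//.
move: yx; rewrite ltr_pdivlMr// mulrC; apply: le_lt_trans.
by rewrite ler_wpM2r ?rnorm_ge0// (le_trans (ler_norm _))// lerDl.
Qed.

Lemma dualE0 phi : phi 0 = 0.
Proof.
have := dual_linear phi 1 0 0; rewrite scaler0 addr0 scale1r => /eqP.
by rewrite -subr_eq0 opprD addrA subrr add0r oppr_eq0 => /eqP.
Qed.

Lemma dualD phi x y : phi (x + y) = phi x + phi y.
Proof. by have := dual_linear phi 1 x y; rewrite !scale1r. Qed.

Lemma dualZ phi (a : R[i]) x : phi (a *: x) = a * phi x.
Proof. by have := dual_linear phi a x 0; rewrite dualE0 !addr0. Qed.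

Lemma dualB phi x y : phi (x - y) = phi x - phi y.
Proof. by rewrite -[- y]scaleN1r dualD dualZ mulN1r. Qed.

Lemma dual_subE phi psi x : (phi - psi) x = phi x - psi x.
Proof. by []. Qed.

Lemma dual_scaleE (a : R[i]) phi x : (a *: phi) x = a * phi x.
Proof. by []. Qed.

Lemma dual_le phi x : rnorm (phi x) <= rnorm phi * rnorm x.
Proof.
have [->|x0] := eqVneq x 0; first by rewrite dualE0 !rnorm0 mulr0.
have xp := rnorm_gt0 x0.
have Bx : unit_ball ((rnorm x)^-1%:C *: x).
  by rewrite /unit_ball /= rnormZr ?invr_ge0 ?rnorm_ge0// mulVf// gt_eqF.
have := sup_norm_ub (dual_bounded phi) Bx.
rewrite -dual_rnormE dualZ rnormM rnorm_real ger0_norm ?invr_ge0 ?rnorm_ge0//.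
by rewrite mulrC ler_pdivrMr.
Qed.

Lemma dual_norm_le phi (C : R) : 0 <= C ->
  (forall x, rnorm (phi x) <= C * rnorm x) -> rnorm phi <= C.
Proof.
move=> C0 h; rewrite dual_rnormE; apply: sup_norm_le => x Bx.
by rewrite (le_trans (h x))// ler_piMr.
Qed.

(** The modulus of smoothness is o(t). One scale [t] per [e] is enough: by convexity of the norm the
    inequality persists at all smaller scales. *)
Definition unif_smooth := forall e : R, 0 < e -> exists2 t : R, 0 < t &
  forall x h, rnorm x = 1 -> rnorm h <= 1 ->
    rnorm (x + t%:C *: h) + rnorm (x - t%:C *: h) <= 2 + e * t.

Hypothesis US : unif_smooth.

(* For a norm that is smooth at [x], the one-sided derivative of the norm at [x]
   is odd, hence real-linear. *)
Section Derivative.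
Variable x : X.
Hypothesis x1 : rnorm x = 1.

Let quot h (t : R) := (rnorm (x + t%:C *: h) - 1) / t.
Let Q h := [set quot h t | t in [set t : R | 0 < t]].
(** The difference quotients of a convex function increase with [t], so this infimum is the right
    derivative of the norm at [x] in direction [h]; no limit has to be taken. *)
Let q h := inf (Q h).

Let quot_ge h t : 0 < t -> - rnorm h <= quot h t.
Proof.
move=> t0; rewrite /quot ler_pdivlMr// mulNr lerBrDl.
have := rnorm_le_dist x (- (t%:C *: h)).
by rewrite opprK rnormN rnormZr ?(ltW t0)// x1 mulrC.
Qed.

Let q_le h t : 0 < t -> q h <= quot h t.
Proof.
move=> t0; apply: ge_inf; last by exists t.
by exists (- rnorm h) => _ [s /= s0 <-]; exact: quot_ge.
Qed.

Let q_ge h c : (forall t, 0 < t -> c <= quot h t) -> c <= q h.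
Proof.
move=> hc; apply: lb_le_inf; first by exists (quot h 1); exists 1 => /=.
by move=> _ [s /= s0 <-]; exact: hc.
Qed.

Let q_norm h : q h <= rnorm h.
Proof.
apply: (le_trans (q_le h ltr01)); rewrite /quot scale1r divr1 lerBlDl.
by have := rnormD x h; rewrite x1.
Qed.

Let qD_le h k : q (h + k) <= q h + q k.
Proof.
rewrite -lerBlDl; apply: q_ge => t t0; rewrite lerBlDl -lerBlDr.
apply: q_ge => s s0; rewrite lerBlDr.
have st0 : 0 < s + t by rewrite addr_gt0.
(* With this step length, the point is the convex combination of [x + s h] and [x + t k] with
   weights [t / (s + t)] and [s / (s + t)]. *)
apply: (le_trans (q_le _ (_ : 0 < s * t / (s + t)))).
  by rewrite divr_gt0// mulr_gt0.
rewrite /quot.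
have -> : x + (s * t / (s + t))%:C *: (h + k) =
    (t / (s + t))%:C *: (x + s%:C *: h) + (s / (s + t))%:C *: (x + t%:C *: k).
  rewrite !scalerDr !scalerA -!rmorphM /= addrACA -scalerDl -rmorphD /=.
  rewrite -mulrDl [t + s]addrC divff ?gt_eqF// scale1r.
  by congr (_ + (_%:C *: _ + _%:C *: _)); ring.
have := rnormD ((t / (s + t))%:C *: (x + s%:C *: h)) ((s / (s + t))%:C *: (x + t%:C *: k)).
rewrite !rnormZr ?divr_ge0 ?(ltW s0) ?(ltW t0) ?(ltW st0)//.
set A := rnorm _; set B := rnorm _; set C := rnorm _ => hA.
have u0 : 0 < s * t / (s + t) by rewrite divr_gt0// mulr_gt0.
have -> : (B - 1) / s + (C - 1) / t =
    (t / (s + t) * B + s / (s + t) * C - 1) / (s * t / (s + t)).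
  by field; rewrite !gt_eqF.
by rewrite ler_pM2r ?invr_gt0// lerB.
Qed.

Let q0 : q 0 = 0.
Proof.
apply/eqP; rewrite eq_le; apply/andP; split.
  by have := q_norm 0; rewrite rnorm0.
by apply: q_ge => t t0; rewrite /quot scaler0 addr0 x1 subrr mul0r.
Qed.

(** Here smoothness enters: applied in the direction of the normalized [h] with tolerance
    [e / rnorm h], it bounds the sum of the two opposite quotients by [e]. *)
Let q_symm h : q h + q (- h) <= 0.
Proof.
have [->|h0] := eqVneq h 0; first by rewrite oppr0 q0 addr0.
have hp := rnorm_gt0 h0.
apply/ler_addgt0Pl => e e0; rewrite addr0.
have [|t t0 ht] := US (_ : 0 < e / rnorm h); first by rewrite divr_gt0.
have := ht x ((rnorm h)^-1%:C *: h) x1.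
rewrite rnormZr ?invr_ge0 ?rnorm_ge0// mulVf ?gt_eqF// => /(_ (lexx _)).
rewrite scalerA -rmorphM /= => hh.
have s0 : 0 < t * (rnorm h)^-1 by rewrite mulr_gt0// invr_gt0.
have := lerD (q_le h s0) (q_le (- h) s0); rewrite /quot scalerN => /le_trans; apply.
rewrite -mulrDl ler_pdivrMr//.
have -> : e * (t * (rnorm h)^-1) = e / rnorm h * t by ring.
lra.
Qed.

Let qN h : q (- h) = - q h.
Proof.
have := qD_le h (- h); rewrite subrr q0; have := q_symm h => ? ?.
by apply/eqP; rewrite eq_sym -subr_eq0; apply/eqP; lra.
Qed.

Let qD h k : q (h + k) = q h + q k.
Proof.
have := qD_le (h + k) (- k); rewrite addrK qN; have := qD_le h k => ? ?.
by apply/eqP; rewrite eq_le; apply/andP; split; lra.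
Qed.

Let qZp (r : R) h : 0 < r -> r * q h <= q (r%:C *: h).
Proof.
move=> r0; apply: q_ge => t t0; rewrite mulrC -ler_pdivlMr//.
apply: (le_trans (q_le _ (mulr_gt0 t0 r0))).
rewrite /quot scalerA -rmorphM /=.
by set A := rnorm _; rewrite [leRHS](_ : _ = (A - 1) / (t * r))//; field; rewrite !gt_eqF.
Qed.

Let qZpos (r : R) h : 0 < r -> q (r%:C *: h) = r * q h.
Proof.
move=> r0; apply/eqP; rewrite eq_le qZp// andbT.
have ri : 0 < r^-1 by rewrite invr_gt0.
have := qZp (r%:C *: h) ri; rewrite scalerA -rmorphM /= mulVf ?gt_eqF// scale1r.
by rewrite mulrC ler_pdivrMr// mulrC.
Qed.

Let qZ (r : R) h : q (r%:C *: h) = r * q h.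
Proof.
have [r0|r0|->] := ltgtP r 0; last by rewrite scale0r q0 mul0r.
  have nr : 0 < - r by rewrite oppr_gt0.
  by have := qZpos h nr; rewrite rmorphN /= scaleNr qN mulNr => /oppr_inj.
exact: qZpos.
Qed.

(** The complex-linear functional whose real part is the real-linear [q]. *)
Let phi h : R[i]^o := (q h +i* - q ('i *: h))%C.

Let complex_split (a : R[i]) h :
  a *: h = (complex.Re a)%:C *: h + (complex.Im a)%:C *: ('i *: h).
Proof.
rewrite scalerA -scalerDl; congr (_ *: _).
by case: a => a b; apply/eqP; rewrite eq_complex /=; apply/andP; split; apply/eqP; ring.
Qed.

Let phi_linear : linear phi.
Proof.
move=> a h k; rewrite -[RHS]/(a * phi h + phi k).
have qa l : q (a *: l) = complex.Re a * q l + complex.Im a * q ('i *: l).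
  by rewrite complex_split qD !qZ.
have ii l : 'i *: ('i *: l) = - l :> X.
  rewrite scalerA (_ : 'i * 'i = -1) ?scaleN1r//.
  by apply/eqP; rewrite eq_complex /=; apply/andP; split; apply/eqP; ring.
rewrite /phi scalerDr scalerA ['i * a]mulrC -scalerA !qD !qa ii qN.
case: a {qa} => a b; apply/eqP; rewrite eq_complex /=; apply/andP; split; apply/eqP; ring.
Qed.

Let phi_le h : rnorm (phi h) <= rnorm h.
Proof.
have [c c1 hc] := unit_phaseV (phi h).
pose L : {linear X -> R[i]^o} := HB.pack phi (GRing.isLinear.Build _ _ _ _ _ phi_linear).
have : phi (c *: h) = (rnorm (phi h))%:C.
  by rewrite -hc; exact: (linearZ_LR L).
move=> /(congr1 (@complex.Re R)) /= <-; apply: (le_trans (q_norm _)).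
by rewrite rnormZ c1 mul1r.
Qed.

Let phi_x : phi x = 1.
Proof.
have qx : q x = 1.
  apply/eqP; rewrite eq_le; apply/andP; split; first by rewrite -[leRHS]x1 q_norm.
  apply: q_ge => t t0; rewrite /quot.
  rewrite (_ : x + t%:C *: x = (1 + t)%:C *: x); last by rewrite rmorphD scalerDl scale1r.
  rewrite rnormZr ?addr_ge0 ?(ltW t0)// x1.
  by rewrite mulr1 addrAC subrr add0r divff// gt_eqF.
(* The real part [q x = 1] already exhausts the bound [rnorm (phi x) <= 1], so the imaginary part
   vanishes. *)
have := phi_le x; rewrite -(@ler_pXn2r _ 2) ?nnegrE ?rnorm_ge0// sqr_rnorm x1 /phi /= qx.
rewrite expr1n gerDl sqrrN => q2.
have : q ('i *: x) ^+ 2 = 0 by apply/eqP; rewrite eq_le q2 sqr_ge0.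
by move=> /eqP; rewrite sqrf_eq0 => /eqP ->; rewrite oppr0.
Qed.

Lemma support_functional :
  exists2 phi : dual X, phi x = 1 & forall h, rnorm (phi h) <= rnorm h.
Proof.
have phiP : phi \in @cont_linear R X.
  rewrite inE /=; split=> //; apply: (@linear_rnorm_continuous _ _ _ 1) => // h.
  by rewrite mul1r.
by exists (@Dual R X phi phiP).
Qed.

End Derivative.

(** Takes the place of the Hahn-Banach theorem: the derivative of the norm at the normalized [v]
    norms [v]. *)
Lemma norming_functional v : exists2 phi : dual X,
  phi v = (rnorm v)%:C & forall h, rnorm (phi h) <= rnorm h.
Proof.
have [->|v0] := eqVneq v 0.
  exists 0 => [|h]; first by rewrite rnorm0.
  by rewrite -[(0 : dual X) h]/(0 : R[i]^o) rnorm0 rnorm_ge0.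
have vp := rnorm_gt0 v0.
have [|phi phi1 phi_le] := @support_functional ((rnorm v)^-1%:C *: v).
  by rewrite rnormZr ?invr_ge0 ?rnorm_ge0// mulVf// gt_eqF.
exists phi => //; move: phi1; rewrite dualZ => h.
have -> : phi v = (rnorm v)%:C * ((rnorm v)^-1%:C * phi v).
  by rewrite mulrA -rmorphM /= mulfV ?gt_eqF// mul1r.
by rewrite h mulr1.
Qed.

Lemma norming_pair x : rnorm x = 1 -> exists phi, duality_pairs (x, phi).
Proof.
move=> x1; have [phi hx hle] := norming_functional x; exists phi; split=> //=.
  apply/eqP; rewrite eq_le; apply/andP; split.
    by apply: dual_norm_le => // h; rewrite mul1r.
  by have := dual_le phi x; rewrite hx x1 rnorm1 mulr1.
by rewrite hx x1.
Qed.

Lemma pair_le (z : X * dual X) h : duality_pairs z -> rnorm (z.2 h) <= rnorm h.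
Proof. by move=> [_ z1 _]; have := dual_le z.2 h; rewrite z1 mul1r. Qed.

(** Smoothness is tested at [w.1] in a direction [k] of the ball. The functional [z.2] bounds the
    norm of [w.1 + t k] from below up to [rnorm (z.1 - w.1)], and [w.2] bounds that of [w.1 - t k].
    Adding the two leaves the real part of [(z.2 - w.2) k] at most [e / 3 + e / 3]; a phase turns
    this into a bound on the modulus. *)
Lemma duality_map_unif_cont (e : R) : 0 < e -> exists2 d : R, 0 < d &
  forall z w : X * dual X, duality_pairs z -> duality_pairs w ->
    rnorm (z.1 - w.1) < d -> rnorm (z.2 - w.2) < e.
Proof.
move=> e0; have [|t t0 ht] := US (_ : 0 < e / 3); first by rewrite divr_gt0.
exists (e / 3 * t) => [|z w Pz Pw zw]; first by rewrite mulr_gt0// divr_gt0.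
apply: (@le_lt_trans _ _ (2 * (e / 3))); last by lra.
rewrite dual_rnormE; apply: sup_norm_le => h Bh; rewrite dual_subE.
have [c c1 hc] := unit_phaseV (z.2 h - w.2 h).
have -> : rnorm (z.2 h - w.2 h) = complex.Re (z.2 (c *: h)) - complex.Re (w.2 (c *: h)).
  by rewrite -raddfB /= !dualZ -mulrBr hc.
set k := c *: h.
have Bk : rnorm k <= 1 by rewrite /k rnormZ c1 mul1r.
have [z1 _ zz] := Pz; have [w1 _ ww] := Pw.
have hz : 1 + t * complex.Re (z.2 k) <= rnorm (w.1 + t%:C *: k) + rnorm (z.1 - w.1).
  have : complex.Re (z.2 (z.1 + t%:C *: k)) <= rnorm (z.1 + t%:C *: k).
    by rewrite (le_trans (Re_le_rnorm _))// pair_le.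
  rewrite dualD dualZ zz raddfD /= Re_scale => /le_trans; apply.
  have := rnormD (w.1 + t%:C *: k) (z.1 - w.1).
  by rewrite addrAC addrCA subrr addr0 addrC.
have hw : 1 - t * complex.Re (w.2 k) <= rnorm (w.1 - t%:C *: k).
  have : complex.Re (w.2 (w.1 - t%:C *: k)) <= rnorm (w.1 - t%:C *: k).
    by rewrite (le_trans (Re_le_rnorm _))// pair_le.
  by rewrite dualB dualZ ww raddfB /= Re_scale.
have := ht w.1 k w1 Bk => hs.
rewrite -(ler_pM2l t0); nra.
Qed.

End Duality.
Arguments unif_smooth {R} X.

(** * Slices and peak functions *)

Lemma invSn_lt (R : realType) (e : R) : 0 < e ->
  exists N, forall n, (N <= n)%N -> n.+1%:R^-1 < e.
Proof.
move=> e0; have /cvg_Rseqn/(_ e e0)[N hN] := @cvg_harmonic R.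
exists N => n Nn; have := hN n Nn; rewrite subr0 /=; apply: le_lt_trans; exact: ler_norm.
Qed.

Section Slices.
Context {R : realType} {V X : normedModType R[i]} {I : Type}.
Variables (K : set I) (val : V -> I -> R) (pos : I -> X).
Implicit Types (f g : V) (i j : I).

(** A common frame for both notions of peak. For the norm, [K] is the unit ball and [pos] the
    identity; for the numerical radius, [K] is [duality_pairs] and [pos] the first projection, so
    that only the point of a pair is controlled. *)
Definition slice_sup f := sup [set val f i | i in K].

Definition small_slice (e : R) : set V := [set f | exists2 d : R, 0 < d &
  forall i j, K i -> K j -> slice_sup f - d < val f i -> slice_sup f - d < val f j ->
    rnorm (pos i - pos j) < e].

Definition peaks_at f (t : X) := forall u : nat -> I, (forall n, K (u n)) ->
  val f (u n) @[n --> \oo] --> slice_sup f -> pos (u n) @[n --> \oo] --> t.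

Hypothesis K0 : K !=set0.
Hypothesis val_le : forall f i, K i -> val f i <= rnorm f.
Hypothesis val_lip : forall f g i, K i -> val f i <= val g i + rnorm (f - g).

Lemma le_slice_sup f i : K i -> val f i <= slice_sup f.
Proof.
move=> Ki; apply: ub_le_sup; last by exists i.
by exists (rnorm f) => _ [j Kj <-]; exact: val_le.
Qed.

Lemma slice_sup_le f M : (forall i, K i -> val f i <= M) -> slice_sup f <= M.
Proof.
move=> h; apply: ge_sup; last by move=> _ [i Ki <-]; exact: h.
by have [i Ki] := K0; exists (val f i); exists i.
Qed.

Lemma slice_sup_approx f (e : R) : 0 < e -> exists2 i, K i & slice_sup f - e < val f i.
Proof.
move=> e0; have [|_ [i Ki <-] h] := @sup_adherent R [set val f i | i in K] e e0.
  split; first by have [i Ki] := K0; exists (val f i); exists i.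
  by exists (rnorm f) => _ [j Kj <-]; exact: val_le.
by exists i.
Qed.

Lemma slice_sup_lip f g : slice_sup f <= slice_sup g + rnorm (f - g).
Proof.
apply: slice_sup_le => i Ki; apply: (le_trans (val_lip f g Ki)).
by rewrite lerD2r le_slice_sup.
Qed.

(** Moving [f] by less than [d / 3] moves each value and the supremum by less than [d / 3], so a
    slice of depth [d / 3] of the new function lies in the slice of depth [d] of the old one. *)
Lemma open_small_slice e : open (small_slice e).
Proof.
apply/open_rnormP => f [d d0 fd]; exists (d / 3); first by rewrite divr_gt0.
move=> g gf; exists (d / 3) => [|i j Ki Kj hi hj]; first by rewrite divr_gt0.
have := slice_sup_lip f g; rewrite rnormBC => ?.
by apply: fd => //; [have := val_lip g f Ki|have := val_lip g f Kj]; lra.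
Qed.

Lemma slice_sup_cvgP f (u : nat -> I) : (forall n, K (u n)) ->
  val f (u n) @[n --> \oo] --> slice_sup f <->
  (forall e : R, 0 < e -> exists N, forall n, (N <= n)%N -> slice_sup f - e < val f (u n)).
Proof.
move=> Ku; rewrite cvg_Rseqn; split=> h e e0; have [N hN] := h e e0; exists N => n Nn.
  by have := hN n Nn; rewrite ltr_norml => /andP[? _]; lra.
rewrite ler0_norm ?subr_le0 ?le_slice_sup//; have := hN n Nn; lra.
Qed.

Lemma slice_sup_cvg f : exists2 u : nat -> I, (forall n, K (u n)) &
  val f (u n) @[n --> \oo] --> slice_sup f.
Proof.
have a n : {i | K i /\ slice_sup f - n.+1%:R^-1 < val f i}.
  apply: cid; have [|i Ki hi] := @slice_sup_approx f n.+1%:R^-1; first by rewrite invr_gt0.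
  by exists i.
have Ka n : K (sval (a n)) by have [] := svalP (a n).
exists (fun n => sval (a n)) => //; apply/slice_sup_cvgP => // e e0.
have [N hN] := invSn_lt e0; exists N => n Nn.
have [_] := svalP (a n); apply: le_lt_trans.
by rewrite lerD2l lerN2 ltW// hN.
Qed.

(** If slices shrink, any two maximizing sequences approach each other; completeness gives one of
    them a limit, which is then common to all. Conversely, if the slices of depth [k.+1%:R^-1] all
    contained two points at distance at least [n.+1%:R^-1], these pairs would form two maximizing
    sequences with the same limit. *)
Lemma peaks_atP f : seq_complete X ->
  (forall n, small_slice n.+1%:R^-1 f) <-> exists t, peaks_at f t.
Proof.
move=> cX; split=> [h|[t ft] n].
  have cauchy (u v : nat -> I) : (forall n, K (u n)) -> (forall n, K (v n)) ->
      val f (u n) @[n --> \oo] --> slice_sup f -> val f (v n) @[n --> \oo] --> slice_sup f ->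
      forall e : R, 0 < e -> exists N, forall m n, (N <= m)%N -> (N <= n)%N ->
        rnorm (pos (u m) - pos (v n)) < e.
    move=> Ku Kv /slice_sup_cvgP-/(_ Ku) fu /slice_sup_cvgP-/(_ Kv) fv e e0.
    have [k hk] := invSn_lt e0; have [d d0 hd] := h k.
    have [N1 h1] := fu d d0; have [N2 h2] := fv d d0; exists (maxn N1 N2) => m n.
    rewrite !geq_max => /andP[m1 m2] /andP[n1 n2]; apply: lt_trans (hk k (leqnn k)).
    by apply: hd => //; [exact: h1|exact: h2].
  have [u Ku fu] := slice_sup_cvg f.
  have [t ut] := cX _ (cauchy _ _ Ku Ku fu fu); exists t => v Kv fv.
  apply/cvg_seqP => e e0; have e20 : 0 < e / 2 by rewrite divr_gt0.
  have [N hN] := cauchy _ _ Kv Ku fv fu _ e20.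
  move/cvg_seqP: ut => /(_ _ e20)[M hM]; exists N => n Nn.
  apply: (le_lt_trans (rnormBD (pos (u (maxn M N))) _ _)).
  have := hN n _ Nn (leq_maxr M N); have := hM _ (leq_maxl M N); lra.
apply: contrapT => hn.
have e0 : 0 < n.+1%:R^-1 :> R by rewrite invr_gt0.
have a k : {p : I * I | [/\ K p.1, K p.2, slice_sup f - k.+1%:R^-1 < val f p.1,
    slice_sup f - k.+1%:R^-1 < val f p.2 & n.+1%:R^-1 <= rnorm (pos p.1 - pos p.2)]}.
  apply: cid; apply: contrapT => hk; apply: hn; exists k.+1%:R^-1; first by rewrite invr_gt0.
  move=> i j Ki Kj hi hj; rewrite ltNge; apply/negP => hij; apply: hk; by exists (i, j).
have cvgt (s : I * I -> I) : (forall k, K (s (sval (a k)))) ->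
    (forall k, slice_sup f - k.+1%:R^-1 < val f (s (sval (a k)))) ->
    exists N, forall k, (N <= k)%N -> rnorm (pos (s (sval (a k))) - t) < n.+1%:R^-1 / 2.
  move=> Ks hs; have e20 : 0 < n.+1%:R^-1 / 2 :> R by rewrite divr_gt0.
  have /cvg_seqP : pos (s (sval (a k))) @[k --> \oo] --> t.
    apply: ft => //; apply/slice_sup_cvgP => // e e1.
    have [N hN] := invSn_lt e1; exists N => k Nk.
    by apply: le_lt_trans (hs k); rewrite lerD2l lerN2 ltW// hN.
  by apply.
have [|k|N1 h1] := cvgt fst; [by move=> k; have [] := svalP (a k)|by have [] := svalP (a k)|].
have [|k|N2 h2] := cvgt snd; [by move=> k; have [] := svalP (a k)|by have [] := svalP (a k)|].
have := h1 _ (leq_maxl N1 N2); have := h2 _ (leq_maxr N1 N2).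
have [_ _ _ _] := svalP (a (maxn N1 N2)).
move: (n.+1%:R^-1) (pos (sval (a (maxn N1 N2))).1) (pos (sval (a (maxn N1 N2))).2) => r q1 q2.
have := rnormBD t q1 q2; rewrite (rnormBC t); lra.
Qed.

End Slices.

Section PeakFunctions.
Context {R : realType} {X : normedModType R[i]} {k : ball_class}.
Implicit Types (f g : ball_algebra X k) (t x : X) (z w : X * dual X).

Definition norm_val (f : ball_algebra X k) (x : X) := rnorm (f x).
Definition pair_val (f : ball_algebra X k) (z : X * dual X) := pairing f z.

Lemma ball_algebra_le f x : unit_ball x -> rnorm (f x) <= rnorm f.
Proof. by move=> Bx; rewrite ball_rnormE; apply: sup_norm_ub => //; exact: ball_bounded. Qed.

Lemma ball_subE f g x : (f - g) x = f x - g x.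
Proof. by []. Qed.

Lemma ball_addE f g x : (f + g) x = f x + g x.
Proof. by []. Qed.

Lemma norm_val_lip f g x : unit_ball x -> norm_val f x <= norm_val g x + rnorm (f - g).
Proof.
move=> Bx; rewrite addrC -lerBlDr (le_trans (rnorm_le_dist _ _))// -ball_subE.
exact: ball_algebra_le.
Qed.

Lemma pair_ball z : duality_pairs z -> unit_ball z.1.
Proof. by move=> [z1 _ _]; rewrite /unit_ball /= z1. Qed.

Lemma pair_val_le f z : duality_pairs z -> pair_val f z <= rnorm f.
Proof.
by move=> Pz; rewrite (le_trans (pair_le _ Pz))// ball_algebra_le//; exact: pair_ball.
Qed.

Lemma pair_val_lip f g z : duality_pairs z -> pair_val f z <= pair_val g z + rnorm (f - g).
Proof.
move=> Pz; rewrite addrC -lerBlDr (le_trans (rnorm_le_dist _ _))// -dualB.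
exact: (pair_val_le (f - g)).
Qed.

Lemma ball_fun_cvg f (u : nat -> X) t : (forall n, unit_ball (u n)) ->
  u @ \oo --> t -> f (u n) @[n --> \oo] --> f t.
Proof.
move=> Bu ut.
have Bt : unit_ball t by apply: (@rnorm_lim_le _ _ u t 1 0) => // n _; exact: Bu.
have := ball_funP f; rewrite inE /= => -[_ _ /subspace_continuousP/(_ t Bt) ft _ _].
have hu : u @ \oo `=>` within unit_ball (nbhs t).
  move=> A /ut; rewrite /= => -[N _ hN]; exists N => // n Nn; exact: hN n Nn (Bu n).
exact: (cvg_comp _ _ hu ft).
Qed.

Lemma slice_sup_norm f : slice_sup unit_ball norm_val f = rnorm f.
Proof. by []. Qed.

(** The convergence clause implies the others: continuity along a maximizing sequence shows that the
    maximum is attained at the limit, and constant sequences show uniqueness. *)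
Lemma norm_strong_peakP f :
  norm_strong_peak f <-> exists t, peaks_at unit_ball norm_val id f t.
Proof.
split=> [[t [_ _ _ ft]]|[t ft]]; first by exists t.
have [u Bu fu] := @slice_sup_cvg R (ball_algebra X k) X unit_ball norm_val
  (ex_intro _ _ unit_ball0) ball_algebra_le f.
have ut := ft u Bu fu; exists t; split=> //.
- by apply: (@rnorm_lim_le _ _ u t 1 0) => // n _; exact: Bu.
- apply: cvg_Rseq_unique fu => //.
  by apply: cvg_rnorm; exact: ball_fun_cvg.
- move=> s Bs fs; have : s @[_ --> \oo] --> t.
    by apply: (ft (fun=> s)) => //; rewrite /norm_val fs; exact: cvg_cst.
  exact: cvg_seq_cst.
Qed.

Hypothesis US : unif_smooth X.

Lemma duality_pairs_cvg (z_ : nat -> X * dual X) z : (forall n, duality_pairs (z_ n)) ->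
  duality_pairs z -> (z_ n).1 @[n --> \oo] --> z.1 -> (z_ n).2 @[n --> \oo] --> z.2.
Proof.
move=> Pz_ Pz /cvg_seqP h; apply/cvg_seqP => e e0.
have [d d0 hd] := duality_map_unif_cont US e0.
by have [N hN] := h d d0; exists N => n Nn; apply: hd => //; exact: hN.
Qed.

Lemma tau_cvg_pairs (z_ : nat -> X * dual X) z : (forall n, duality_pairs (z_ n)) ->
  duality_pairs z -> (z_ n).1 @[n --> \oo] --> z.1 -> tau_cvg z_ z.
Proof.
move=> Pz_ Pz h; have /cvg_seqP h2 := duality_pairs_cvg Pz_ Pz h.
suff hw : weak_star (z_ n).2 @[n --> \oo] --> weak_star z.2.
  exact: (cvg_pair (G := nbhs z.1) (H := nbhs (weak_star z.2)) h hw).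
apply/pointwise_cvgP => x; apply/cvg_seqP => e e0.
have x1 : 0 < rnorm x + 1 by rewrite ltr_wpDl// rnorm_ge0.
have [|N hN] := h2 (e / (rnorm x + 1)); first by rewrite divr_gt0.
exists N => n Nn; rewrite -[_ - _]/(((z_ n).2 - z.2) x) (le_lt_trans (dual_le _ _))//.
have := hN n Nn; rewrite ltr_pdivlMr//; apply: le_lt_trans.
by rewrite ler_wpM2l ?rnorm_ge0// lerDl.
Qed.

Lemma tau_cvg_fst (z_ : nat -> X * dual X) z : tau_cvg z_ z ->
  (z_ n).1 @[n --> \oo] --> z.1.
Proof. by move=> h; exact: (cvg_comp _ _ h cvg_fst). Qed.

(** Convergence of the points suffices: the limit [t] lies on the sphere, and the functionals follow
    in norm to one that norms [t], since the duality map is uniformly continuous. Hence the pairing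
    passes to the limit and the radius is attained. For uniqueness, constant sequences determine
    both components. *)
Lemma numerical_strong_peakP f : (@duality_pairs R X) !=set0 ->
  numerical_strong_peak f <-> exists t, peaks_at duality_pairs pair_val fst f t.
Proof.
move=> P0; split=> [[z [_ _ _ fz]]|[t ft]].
  by exists z.1 => u Pu fu; apply: tau_cvg_fst; exact: fz.
have [u Pu fu] := @slice_sup_cvg R (ball_algebra X k) (X * dual X)%type duality_pairs pair_val
  P0 pair_val_le f.
have ut := ft u Pu fu.
have t1 : rnorm t = 1.
  apply: cvg_Rseq_unique (cvg_rnorm ut) _ => //.
  by under eq_fun => n do have [-> _ _] := Pu n; exact: cvg_cst.
have [phi Pt] := norming_pair US t1.
have pairs_cvg (z_ : nat -> X * dual X) : (forall n, duality_pairs (z_ n)) ->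
    pairing f (z_ n) @[n --> \oo] --> numerical_radius f ->
    (z_ n).1 @[n --> \oo] --> t.
  by move=> Pz fz; exact: ft.
exists (t, phi); split=> //.
- have /cvg_seqP uphi := duality_pairs_cvg Pu Pt ut.
  have /cvg_seqP fut : f (u n).1 @[n --> \oo] --> f t.
    by apply: ball_fun_cvg => // n; exact: pair_ball.
  apply: cvg_Rseq_unique fu => //.
  apply/cvg_Rseqn => e e0.
  have c0 : 0 < rnorm (f t) + 1 by rewrite ltr_wpDl// rnorm_ge0.
  have [|N1 h1] := uphi (e / 2 / (rnorm (f t) + 1)); first by rewrite !divr_gt0.
  have [|N2 h2] := fut (e / 2); first by rewrite divr_gt0.
  exists (maxn N1 N2) => n; rewrite geq_max => /andP[/h1 {}h1 /h2 {}h2].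
  rewrite /pair_val /pairing (le_lt_trans (rnorm_dist _ _))//=.
  have -> : (u n).2 (f (u n).1) - phi (f t) =
      (u n).2 (f (u n).1 - f t) + ((u n).2 - phi) (f t).
    by rewrite dualB dual_subE addrA subrK.
  rewrite (le_lt_trans (rnormD _ _))//.
  have := pair_le (f (u n).1 - f t) (Pu n) => h3.
  have h4 : rnorm (((u n).2 - phi) (f t)) < e / 2.
    rewrite (le_lt_trans (dual_le _ _))//.
    move: h1; rewrite ltr_pdivlMr//; apply: le_lt_trans.
    by rewrite ler_wpM2l ?rnorm_ge0// lerDl.
  lra.
- move=> w Pw fw.
  have wt : w.1 = t.
    have : w.1 @[_ --> \oo] --> t.
      by apply: (pairs_cvg (fun=> w)) => //; rewrite fw; exact: cvg_cst.
    exact: cvg_seq_cst.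
  have : w.2 @[_ --> \oo] --> phi.
    apply: (@duality_pairs_cvg (fun=> w) (t, phi)) => //=.
    by rewrite wt; exact: cvg_cst.
  move=> /cvg_seq_cst <-.
  by rewrite -wt; case: (w).
- move=> z_ Pz fz; apply: tau_cvg_pairs => //; exact: pairs_cvg.
Qed.

(** Convergence in [tau] contains norm convergence of the points, and the duality map carries it
    over to the functionals. *)
Lemma numerical_very_strong f : numerical_strong_peak f -> very_strong_numerical_peak f.
Proof.
move=> [z fz]; exists z; split=> // z_ Pz_ fz_.
have [Pz _ _ hz] := fz; have zc := tau_cvg_fst (hz z_ Pz_ fz_).
by split=> //; exact: duality_pairs_cvg.
Qed.

End PeakFunctions.

(** * Affine perturbations *)

Section AffinePerturbation.
Context {R : realType} {X : normedModType R[i]}.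
Implicit Types (H G : X -> X) (x y : X) (phi : dual X).

(** These conditions, unlike finite rank in general, survive uniform limits on the ball; [H] is kept
    on all of [X] so that affinity is an algebraic identity. *)
Definition affine_pert H := [/\ linear (fun x => H x - H 0), bounded_on_ball H &
  weakly_unif_cont_on_ball H].

(** Control on the ball spreads to the whole space, because [H x] is [H 0] plus [rnorm x] times the
    increment from 0 to the normalized [x]. Thus a sequence that is Cauchy on the ball converges
    pointwise on all of [X]. *)
Lemma affine_bound H (M : R) : linear (fun x => H x - H 0) ->
  (forall x, unit_ball x -> rnorm (H x) <= M) ->
  forall x, rnorm (H x) <= M * (1 + 2 * rnorm x).
Proof.
move=> lH hM x.
have B0 := hM 0 unit_ball0.
have [->|x0] := eqVneq x 0; first by rewrite rnorm0 mulr0 addr0 mulr1.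
have xp := rnorm_gt0 x0.
have Bx : unit_ball ((rnorm x)^-1%:C *: x).
  by rewrite /unit_ball /= rnormZr ?invr_ge0 ?rnorm_ge0// mulVf// gt_eqF.
have hx : H x = H 0 + (rnorm x)%:C *: (H ((rnorm x)^-1%:C *: x) - H 0).
  have := lH (rnorm x)%:C ((rnorm x)^-1%:C *: x) 0.
  rewrite subrr !addr0 scalerA -rmorphM /= mulfV ?gt_eqF// scale1r => <-.
  by rewrite addrC subrK.
rewrite hx (le_trans (rnormD _ _))// rnormZr ?rnorm_ge0//.
have := rnormB (H ((rnorm x)^-1%:C *: x)) (H 0); have := hM _ Bx => h1 h2.
have : rnorm x * rnorm (H ((rnorm x)^-1%:C *: x) - H 0) <= rnorm x * (M + M).
  by rewrite ler_wpM2l ?rnorm_ge0// (le_trans h2)// lerD.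
lra.
Qed.

Lemma affine_lip H : affine_pert H ->
  exists2 C : R, 0 < C & forall x y, rnorm (H x - H y) <= C * rnorm (x - y).
Proof.
move=> [lH [M hM] _].
pose G x := H x - H 0.
pose L : {linear X -> X} := HB.pack G (GRing.isLinear.Build _ _ _ _ _ lH).
have M0 : 0 <= M by apply: le_trans (hM 0 unit_ball0); exact: rnorm_ge0.
have GB x : unit_ball x -> rnorm (G x) <= M + M.
  by move=> Bx; rewrite (le_trans (rnormB _ _))// lerD// hM//; exact: unit_ball0.
exists (M + M + 1) => [|x y]; first by rewrite ltr_wpDl// addr_ge0.
have -> : H x - H y = G (x - y).
  have -> : G (x - y) = G x - G y by exact: (raddfB L).
  by rewrite /G opprB addrA subrK.
set z := x - y; have [->|z0] := eqVneq z 0.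
  have -> : G 0 = 0 by rewrite /G subrr.
  by rewrite rnorm0 mulr0.
have zp := rnorm_gt0 z0.
have Bz : unit_ball ((rnorm z)^-1%:C *: z).
  by rewrite /unit_ball /= rnormZr ?invr_ge0 ?rnorm_ge0// mulVf// gt_eqF.
have -> : G z = (rnorm z)%:C *: G ((rnorm z)^-1%:C *: z).
  have -> : G ((rnorm z)^-1%:C *: z) = (rnorm z)^-1%:C *: G z by exact: (linearZ_LR L).
  by rewrite scalerA -rmorphM /= mulfV ?gt_eqF// scale1r.
rewrite rnormZr ?rnorm_ge0// mulrC ler_wpM2r ?rnorm_ge0//.
by rewrite (le_trans (GB _ Bz))// lerDl.
Qed.

Definition clip H x : X := if pselect (unit_ball x) then H x else 0.

Lemma clip_in H x : unit_ball x -> clip H x = H x.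
Proof. by rewrite /clip; case: pselect. Qed.

Lemma clip_out H x : ~ unit_ball x -> clip H x = 0.
Proof. by rewrite /clip; case: pselect. Qed.

Lemma clip_affine H k : affine_pert H -> clip H \in @ball_fun_pred R X k.
Proof.
move=> aH; have [C C0 HC] := affine_lip aH; case: aH => lH [M hM] wH.
have uH : unif_cont_on_ball (clip H).
  move=> e e0; exists (e / C) => [|x y Bx By]; first by rewrite divr_gt0.
  by rewrite !clip_in// ltr_pdivlMr// mulrC; apply: le_lt_trans; exact: HC.
have wuH : weakly_unif_cont_on_ball (clip H).
  move=> e e0; have [s [d d0 hs]] := wH e e0; exists s, d => // x y Bx By xy.
  by rewrite !clip_in//; exact: hs.
rewrite inE /=; split.
- by move=> x; exact: clip_out.
- by exists M => x Bx; rewrite clip_in//; exact: hM.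
- apply/subspace_continuousP => x Bx; apply/cvg_rnormP => e e0.
  have [d d0 hd] := uH e e0.
  have /(cvg_rnormP _ id)/(_ d d0) : id @ x --> x by exact: cvg_id.
  by rewrite near_withinE; apply: filterS => y xy By; exact: hd.
- move=> x /= x1.
  pose G y := H y - H 0.
  pose L : {linear X -> X} := HB.pack G (GRing.isLinear.Build _ _ _ _ _ lH).
  have Gc : continuous G.
    apply: (linear_rnorm_continuous (C := C) lH) => y.
    by rewrite /G (le_trans (HC _ _))// subr0.
  (* Within distance [1 - rnorm x] of [x] the map has not been clipped, so the affine expansion is
     exact and the remainder is 0. *)
  have near_aff : clip H \o shift x = cst (clip H x) + L +o_ 0 id.
    apply/eqaddoP => e e0.
    have x0 : 0 < 1 - rnorm x by rewrite subr_gt0.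
    have /(cvg_rnormP _ id)/(_ _ x0) : id @ (0 : X) --> (0 : X) by exact: cvg_id.
    apply: filterS => y; rewrite sub0r rnormN => y1.
    have Bx : unit_ball x by rewrite /unit_ball /= ltW.
    have By : unit_ball (y + x).
      by rewrite /unit_ball /= (le_trans (rnormD _ _))//; lra.
    rewrite -[X in `|X|]/(clip H (y + x) - (clip H x + G y)) !clip_in//.
    have -> : H (y + x) - (H x + G y) = 0.
      have : G (y + x) = G y + G x by exact: (raddfD L).
      by rewrite [X in _ = _ + X]/G addrA => /addIr ->; rewrite addrC subrr.
    by rewrite normr0 mulr_ge0// ltW.
  have dE := diff_unique (Gc : continuous L) near_aff.
  apply/diff_locallyP; rewrite dE; split=> //.
- by case: k.
Qed.

Definition affine_fun k (h : ball_algebra X k) :=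
  exists2 H, affine_pert H & forall x, unit_ball x -> h x = H x.

Lemma affine_fun_ex k H : affine_pert H ->
  exists2 h : ball_algebra X k, affine_fun h & forall x, unit_ball x -> h x = H x.
Proof.
move=> aH; exists (BallAlgebra (clip_affine k aH)) => [|x Bx]; last exact: clip_in.
by exists H => // x Bx; exact: clip_in.
Qed.

Lemma affine_pertD H G : affine_pert H -> affine_pert G ->
  affine_pert (fun x => H x + G x).
Proof.
move=> [lH [M hM] wH] [lG [N hN] wG]; split.
- have E x : H x + G x - (H 0 + G 0) = H x - H 0 + (G x - G 0) by rewrite opprD addrACA.
  by move=> a x y; rewrite !E lH lG [in RHS]scalerDr addrACA.
- by exists (M + N) => x Bx; rewrite (le_trans (rnormD _ _))// lerD ?hM ?hN.
- move=> e e0; have e20 : 0 < e / 2 by rewrite divr_gt0.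
  have [s [d d0 hs]] := wH _ e20; have [t [c c0 ht]] := wG _ e20.
  exists (s ++ t), (Num.min d c); first by rewrite lt_min d0.
  move=> x y Bx By hxy; rewrite opprD addrACA (le_lt_trans (rnormD _ _))//.
  rewrite [ltRHS](splitr e) ltrD//; [apply: hs|apply: ht] => // phi phis.
    by have := hxy phi; rewrite mem_cat phis lt_min => /(_ isT)/andP[].
  by have := hxy phi; rewrite mem_cat phis orbT lt_min => /(_ isT)/andP[].
Qed.

Lemma affine_pert_rank1 (c : R[i]) phi y : affine_pert (fun x => (c + phi x) *: y).
Proof.
split.
- move=> a u v; rewrite !dualE0 -!scalerBl dualD dualZ scalerA -scalerDl.
  by congr (_ *: _); rewrite addr0 addrAC subrr add0r ![c + _ - c]addrAC subrr !add0r.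
- exists ((rnorm (c : R[i]^o) + rnorm phi) * rnorm y) => x Bx.
  rewrite rnormZ ler_wpM2r ?rnorm_ge0// (le_trans (rnormD _ _))// lerD2l.
  by rewrite (le_trans (dual_le _ _))// ler_piMr ?rnorm_ge0.
- move=> e e0; have y0 : 0 < rnorm y + 1 by rewrite ltr_wpDl// rnorm_ge0.
  exists [:: phi], (e / (rnorm y + 1)) => [|u v _ _ /(_ phi)]; first by rewrite divr_gt0.
  rewrite inE eqxx => /(_ isT); rewrite ltr_pdivlMr//; apply: le_lt_trans.
  rewrite -scalerBl rnormZ opprD addrACA subrr add0r -dualB.
  by rewrite ler_wpM2l ?rnorm_ge0// lerDl.
Qed.

Lemma affine_fun0 k : affine_fun (0 : ball_algebra X k).
Proof.
exists (fun x => (0 + (0 : dual X) x) *: 0); first exact: affine_pert_rank1.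
by move=> x _; rewrite scaler0.
Qed.

Lemma affine_funD k (g h : ball_algebra X k) :
  affine_fun g -> affine_fun h -> affine_fun (g + h).
Proof.
move=> [G aG gG] [H aH hH]; exists (fun x => G x + H x); first exact: affine_pertD.
by move=> x Bx; rewrite ball_addE gG// hH.
Qed.

Lemma ball_algebra_norm_le k (f : ball_algebra X k) (M : R) :
  (forall x, unit_ball x -> rnorm (f x) <= M) -> rnorm f <= M.
Proof. by move=> h; rewrite ball_rnormE; exact: sup_norm_le. Qed.

(** This is the restricted completeness required by [baire_relative]. The affine increments converge
    pointwise on [X] and uniformly on the ball; the limit is affine and weakly uniformly continuous,
    so its clipping belongs to each of the three algebras. *)
Lemma affine_increments_cvg k (u : nat -> ball_algebra X k) : seq_complete X ->
  (forall e : R, 0 < e -> exists N, forall m n, (N <= m)%N -> (N <= n)%N ->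
    rnorm (u m - u n) < e) ->
  (forall n, affine_fun (u n - u 0)) -> exists l : ball_algebra X k, u @ \oo --> l.
Proof.
move=> cX uC aff.
pose H n := s2val (cid2 (aff n)).
have aH n : affine_pert (H n) by exact: (s2valP (cid2 (aff n))).
have HE n x : unit_ball x -> H n x = u n x - u 0 x.
  by move=> Bx; rewrite -ball_subE; symmetry; exact: (s2valP' (cid2 (aff n))).
have Hdist m n x : rnorm (H m x - H n x) <= rnorm (u m - u n) * (1 + 2 * rnorm x).
  apply: (@affine_bound (fun x => H m x - H n x)).
    have [lm _ _] := aH m; have [ln _ _] := aH n => a y z.
    have E x' : H m x' - H n x' - (H m 0 - H n 0) = H m x' - H m 0 - (H n x' - H n 0).
      by rewrite !opprD addrACA.
    by rewrite !E lm ln opprD addrACA -scalerBr.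
  move=> y By; rewrite !HE// opprB addrA subrK -ball_subE; exact: ball_algebra_le.
have Hcvg x : exists l : X, H n x @[n --> \oo] --> l.
  have x1 : 0 < 1 + 2 * rnorm x by rewrite ltr_pwDl// mulr_ge0// rnorm_ge0.
  apply: (cX (H^~ x)) => e e0; have [|N hN] := uC (e / (1 + 2 * rnorm x)); first by rewrite divr_gt0.
  exists N => m n Nm Nn; rewrite (le_lt_trans (Hdist _ _ _))//.
  by rewrite -ltr_pdivlMr// hN.
pose G x := sval (cid (Hcvg x)).
have GP x : H n x @[n --> \oo] --> G x by exact: (svalP (cid (Hcvg x))).
have Gunif (e : R) : 0 < e -> exists N, forall n x, (N <= n)%N -> unit_ball x ->
    rnorm (G x - H n x) <= e.
  move=> e0; have [|N hN] := uC (e / 3); first by rewrite divr_gt0.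
  exists N => n x Nn Bx.
  apply: (@rnorm_lim_le _ _ (fun m => H m x - H n x) _ _ N).
    by apply: cvgB; [exact: GP|exact: cvg_cst].
  move=> m Nm; apply: (le_trans (Hdist _ _ _)).
  have := hN m n Nm Nn; move: Bx; rewrite /unit_ball /=.
  have := rnorm_ge0 x; have := rnorm_ge0 (u m - u n); nra.
have aG : affine_pert G.
  split.
  - move=> a x y.
    apply: (@cvg_seq_unique _ _ (fun n => H n (a *: x + y) - H n 0)).
      by apply: cvgB; exact: GP.
    have -> : (fun n => H n (a *: x + y) - H n 0) =
        (fun n => a *: (H n x - H n 0) + (H n y - H n 0)).
      by apply/funext => n; have [lH _ _] := aH n; exact: lH.
    apply: cvgD; last by apply: cvgB; exact: GP.
    by apply: cvgZl_tmp; apply: cvgB; exact: GP.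
  - have [N hN] := Gunif 1 ltr01; have [_ [M hM] _] := aH N; exists (1 + M) => x Bx.
    have := hN N x (leqnn N) Bx; have := hM x Bx.
    have := rnorm_le_dist (G x) (H N x); lra.
  - move=> e e0; have [|N hN] := Gunif (e / 4); first by rewrite divr_gt0.
    have [_ _ /(_ (e / 4))[|s [d d0 hs]]] := aH N; first by rewrite divr_gt0.
    exists s, d => // x y Bx By xy.
    have := rnormBD (H N x) (G x) (G y); have := rnormBD (H N y) (H N x) (G y).
    have := hN N x (leqnn N) Bx; have := hN N y (leqnn N) By.
    have := hs x y Bx By xy; rewrite (rnormBC (G y)); lra.
have [h _ hG] := affine_fun_ex k aG.
exists (u 0 + h); apply/cvg_seqP => e e0.
have [|N hN] := Gunif (e / 2); first by rewrite divr_gt0.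
exists N => n Nn; apply: (@le_lt_trans _ _ (e / 2)); last by lra.
apply: ball_algebra_norm_le => x Bx; rewrite ball_subE ball_addE hG// opprD addrA -HE//.
by rewrite rnormBC hN.
Qed.

End AffinePerturbation.

(** * Density of small slices *)

Lemma ler_powRl (R : realType) (p x y : R) : 0 < p -> 0 <= x -> x <= y ->
  x `^ p <= y `^ p.
Proof.
move=> p0 x0 xy; apply: ge0_ler_powR; rewrite ?nnegrE//; first exact: ltW.
exact: le_trans xy.
Qed.

(** The tangent line inequality for the convex power function, obtained from Young's inequality for
    [u] and [v] to the power [p - 1], with exponents [p] and [p / (p - 1)]. *)
Lemma powR_tangent (R : realType) (p u v : R) : 1 < p -> 0 <= u -> 0 <= v ->
  v `^ p + p * v `^ (p - 1) * (u - v) <= u `^ p.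
Proof.
move=> p1 u0 v0; have p0 : 0 < p by exact: lt_trans p1.
have pm : 0 < p - 1 by lra.
have := @conjugate_powR R u (v `^ (p - 1)) p (p / (p - 1)) u0 (powR_ge0 _ _) p0
  (divr_gt0 p0 pm).
rewrite -powRrM (_ : (p - 1) * (p / (p - 1)) = p); last by field; rewrite gt_eqF.
have -> : p^-1 + (p / (p - 1))^-1 = 1 by field; rewrite !gt_eqF.
move=> /(_ erefl) h.
have vE : v `^ (p - 1) * v = v `^ p by rewrite mulrC mulr_powRB1.
have : p * (u * v `^ (p - 1)) <= u `^ p + (p - 1) * v `^ p.
  have -> : u `^ p + (p - 1) * v `^ p = p * (u `^ p / p + v `^ p / (p / (p - 1))).
    by field; rewrite !gt_eqF.
  by rewrite ler_pM2l.
rewrite -!vE; lra.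
Qed.

Lemma almost_max (R : realType) (T : Type) (K : set T) (F : T -> R) (M e : R) :
  K !=set0 -> (forall x, K x -> F x <= M) -> 0 < e ->
  exists2 x, K x & forall y, K y -> F y <= F x + e.
Proof.
move=> [x0 Kx0] FM e0.
have hs : has_sup [set F x | x in K].
  by split; [exists (F x0); exists x0|exists M => _ [x Kx <-]; exact: FM].
have [_ [x Kx <-] hx] := sup_adherent e0 hs.
exists x => // y Ky; have : F y <= sup [set F x | x in K].
  by apply: ub_le_sup; [exact: hs.2|exists y].
by move: hx; rewrite ltrBlDr => /ltW /[swap]; exact: le_trans.
Qed.

(** The convexity gap is taken for the p-th power of the norm: it then also separates points of
    different norms in the ball, and in [L_p] it is an integral. *)
Definition unif_convex (R : realType) (p : R) (X : normedModType R[i]) :=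
  forall e : R, 0 < e -> exists2 d : R, 0 < d & forall x y : X,
    unit_ball x -> unit_ball y ->
    (rnorm x `^ p + rnorm y `^ p) / 2 - rnorm ((2^-1)%:C *: (x + y)) `^ p < d ->
    rnorm (x - y) < e.

Section Density.
Context {R : realType} {X : normedModType R[i]} {k : ball_class} {p : R}.
Hypotheses (p1 : 1 < p) (UC : unif_convex p X) (US : unif_smooth X).
Implicit Types (f g h : ball_algebra X k) (x y w : X) (z : X * dual X) (phi : dual X).

Lemma small_slice_center (I : Type) (K : set I) (val : ball_algebra X k -> I -> R)
    (pos : I -> X) f (d e : R) x : 0 < d ->
  (forall i, K i -> slice_sup K val f - d < val f i -> rnorm (pos i - x) < e / 2) ->
  small_slice K val pos e f.
Proof.
move=> d0 h; exists d => // i j Ki Kj hi hj.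
have := rnormBD x (pos i) (pos j); rewrite (rnormBC x).
have := h i Ki hi; have := h j Kj hj; lra.
Qed.

(** The perturbation [b * phi (x1 + x)] times [x1] raises the value by exactly [t] at [(x1, phi)],
    and at a pair [z] by at most [t / 2 * rnorm (x1 + z.1)]. A pair in the slice thus has a midpoint
    with [x1] of norm close to 1, and uniform convexity brings it close to [x1]. *)
Lemma small_slice_pair_dense f (r e : R) : (@duality_pairs R X) !=set0 ->
  0 < r -> 0 < e -> exists h, [/\ affine_fun h, rnorm h < r &
    small_slice duality_pairs pair_val fst e (f + h)].
Proof.
move=> P0 r0 e0; have p0 : 0 < p by exact: lt_trans p1.
have [|d d0 hd] := UC (_ : 0 < e / 2); first by rewrite divr_gt0.
pose t := r / 2; have t0 : 0 < t by rewrite divr_gt0.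
(* The loss [m] is incurred twice, as near-maximality of [x1] and as slice depth, and
   [m + m = t * q]. So the midpoint has norm above [1 - q], and its p-th power exceeds
   [1 - p * q = 1 - d]. *)
pose q := d / p; have q0 : 0 < q by rewrite divr_gt0.
pose m := t * q / 2; have m0 : 0 < m by rewrite divr_gt0// mulr_gt0.
have pl g z := @pair_val_le R X k g z.
have [[x1 phi] Pz hz] := slice_sup_approx P0 pl f m0.
have [x11 phi1 phix] := Pz; rewrite /= in x11 phi1 phix.
(* The phase of [phi (f x1)] aligns the perturbation with it, so that the moduli add up at [x1]. *)
have [c [c1 hc]] := unit_phase (phi (f x1)).
have t20 : 0 <= t / 2 by rewrite ltW// divr_gt0.
pose b : R[i] := (t / 2)%:C * c.
have bn : rnorm (b : R[i]^o) = t / 2.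
  by rewrite rnormM c1 mulr1 rnorm_real ger0_norm// ltW// divr_gt0.
have [h ah hE] := affine_fun_ex k (affine_pert_rank1 b (b *: phi) x1).
have hE' x : unit_ball x -> h x = (b * phi (x1 + x)) *: x1.
  by move=> Bx; rewrite hE// dualD phix mulrDr mulr1.
exists h; split=> //.
  apply: (@le_lt_trans _ _ t); last by rewrite /t; lra.
  apply: (@ball_algebra_norm_le R X k h) => x Bx; rewrite hE'// rnormZ rnormM bn x11 mulr1.
  have := pair_le (x1 + x) Pz => /= h1; have := rnormD x1 x; rewrite x11 => h2.
  move: Bx; rewrite /unit_ball /= => Bx.
  have hA : rnorm (phi (x1 + x)) <= 2 by lra.
  by have := ler_wpM2l (ltW t0) hA; lra.
have B1 : unit_ball x1 by rewrite /unit_ball /= x11.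
have v1 : pair_val (f + h) (x1, phi) = pair_val f (x1, phi) + t.
  rewrite -[LHS]/(rnorm (phi ((f + h) x1))) -[X in _ = X + _]/(rnorm (phi (f x1))).
  rewrite ball_addE hE'// dualD dualZ dualD phix mulr1 {1}hc.
  have -> : (rnorm (phi (f x1)))%:C * c + b * (1 + 1) = (rnorm (phi (f x1)) + t)%:C * c.
    rewrite /b -mulrA [c * _]mulrC mulrA -mulrDl rmorphD /=; congr ((_ + _) * _).
    have -> : 1 + 1 = (1 + 1)%:C :> R[i] by rewrite rmorphD.
    by rewrite -rmorphM; congr (_%:C); field.
  by rewrite rnormM c1 mulr1 rnorm_real ger0_norm// addr_ge0 ?rnorm_ge0// ltW.
apply: (@small_slice_center _ _ _ _ _ m _ x1) => // z Pz' hz'.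
have Bz := pair_ball Pz'; apply: hd => //.
have le1 := le_slice_sup pl (f + h) Pz; rewrite v1 in le1.
have z1 : pair_val (f + h) z <= slice_sup duality_pairs pair_val f +
    t / 2 * rnorm (x1 + z.1).
  rewrite /pair_val /pairing ball_addE dualD (le_trans (rnormD _ _))// lerD//.
    exact: (le_slice_sup pl f Pz').
  rewrite hE'// dualZ rnormM rnormM bn -mulrA (ler_wpM2l t20)//.
  have h1 : rnorm (z.2 x1) <= 1 by apply: le_trans (pair_le x1 Pz') _; rewrite x11.
  have h2 : rnorm (phi (x1 + z.1)) <= rnorm (x1 + z.1) by exact: (pair_le (x1 + z.1) Pz).
  by rewrite (le_trans (ler_pM _ _ h2 h1)) ?rnorm_ge0// mulr1.
have [z11 _ _] := Pz'; rewrite x11 z11 powR1 rnormZr ?invr_ge0// [z.1 + x1]addrC.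
have n0 : 0 <= 2^-1 * rnorm (x1 + z.1) by rewrite mulr_ge0 ?invr_ge0 ?rnorm_ge0.
have := powR_tangent p1 n0 ler01; rewrite !powR1 mulr1 => ht.
have : 1 - q < 2^-1 * rnorm (x1 + z.1).
  rewrite -(ltr_pM2l t0).
  have : t * q = m + m by rewrite /m; field.
  lra.
have : p * q = d by rewrite /q; field; rewrite gt_eqF.
nra.
Qed.

(** The gradient is [p * rnorm x] to the power [p - 1] times a functional norming [x]; the scalar
    tangent inequality then gives the bound from below. *)
Lemma powR_norm_gradient x : unit_ball x -> exists2 psi : dual X,
  (forall y, rnorm (psi y) <= p * rnorm y) &
  forall y, rnorm x `^ p + complex.Re (psi (y - x)) <= rnorm y `^ p.
Proof.
move=> Bx; have p0 : 0 < p by exact: lt_trans p1.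
have pm : 0 < p - 1 by rewrite subr_gt0.
have [phi phix phile] := norming_functional US x.
pose c := p * rnorm x `^ (p - 1).
have c0 : 0 <= c by rewrite mulr_ge0 ?powR_ge0// ltW.
have cp : c <= p.
  rewrite /c ler_piMr ?(ltW p0)//.
  have [->|x0] := eqVneq (rnorm x) 0; first by rewrite powR0// gt_eqF.
  have x01 : 0 < rnorm x <= 1 by rewrite lt_neqAle eq_sym x0 rnorm_ge0 /=; exact: Bx.
  by have := ger_powR x01 (ltW pm); rewrite powRr0.
exists (c%:C *: phi) => y; rewrite dual_scaleE.
  by rewrite rnormM rnorm_real ger0_norm// ler_pM ?rnorm_ge0.
rewrite Re_scale; have := powR_tangent p1 (rnorm_ge0 y) (rnorm_ge0 x).
apply: le_trans; rewrite lerD2l ler_wpM2l// dualB phix raddfB /= lerD2r.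
by rewrite (le_trans (Re_le_rnorm _)).
Qed.

Lemma small_slice_norm_dense f (r e : R) : (exists x : X, x != 0) ->
  0 < r -> 0 < e -> exists h, [/\ affine_fun h, rnorm h < r &
    small_slice unit_ball norm_val id e (f + h)].
Proof.
move=> [v v0] r0 e0; have p0 : 0 < p by exact: lt_trans p1.
have [|d d0 hd] := UC (_ : 0 < e / 2); first by rewrite divr_gt0.
(* [s0] will bound the distance from [y w] to 1, so that replacing [y w] by 1 in [psi x * y w] costs
   at most [p * s0 = d / 4]. The value of [q] comes from [near1]. *)
pose s0 := d / (4 * p); have s00 : 0 < s0 by rewrite divr_gt0// mulr_gt0.
pose q := s0 ^+ 2 / 2; have q0 : 0 < q by rewrite divr_gt0// exprn_gt0.
pose t := r / 2; have t0 : 0 < t by rewrite divr_gt0.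
pose m := t * q / 4; have m0 : 0 < m by rewrite divr_gt0// mulr_gt0.
(* [s] is so small against [t * q] that the terms of order [s] (twice [s * p], the slice depth, and
   [s] times a p-th power) cannot hide a deviation of [q] in the direction [w]. The second bound
   keeps the perturbation below [t + t = r]. *)
have [s ss0 [s1 s2]] : exists2 s : R, 0 < s & s * (2 * p + d + 1) <= t * q / 2 /\ s * p < t.
  have D0 : 0 < 2 * p + d + 1 by lra.
  exists (Num.min (t * q / 2 / (2 * p + d + 1)) (t / (2 * p))).
    rewrite lt_min; apply/andP; split; last by rewrite divr_gt0// mulr_gt0.
    by rewrite divr_gt0// divr_gt0// mulr_gt0.
  split; first by rewrite -ler_pdivlMr// ge_min lexx.
  rewrite -ltr_pdivlMr// gt_min; apply/orP; right.
  by rewrite ltr_pM2l// ltf_pV2 ?posrE ?mulr_gt0//; lra.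
have nl g x := @ball_algebra_le R X k g x.
have B0 : (@unit_ball R X) !=set0 by exists 0; exact: unit_ball0.
have [x0 Bx0 hx0] := slice_sup_approx B0 nl f m0.
have [w w1 fw] : exists2 w, rnorm w = 1 & f x0 = (rnorm (f x0))%:C *: w.
  (* If [f x0] vanishes, every unit vector can serve as [w]; one exists because [X] is nonzero. *)
  have [->|fx0] := eqVneq (f x0) 0.
    exists ((rnorm v)^-1%:C *: v); last by rewrite rnorm0 scale0r.
    by rewrite rnormZr ?invr_ge0 ?rnorm_ge0// mulVf// gt_eqF// rnorm_gt0.
  have fp := rnorm_gt0 fx0; exists ((rnorm (f x0))^-1%:C *: f x0).
    by rewrite rnormZr ?invr_ge0 ?rnorm_ge0// mulVf// gt_eqF.
  by rewrite scalerA -rmorphM /= mulfV ?gt_eqF// scale1r.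
rewrite slice_sup_norm /norm_val in hx0.
pose f1 x := f x + t%:C *: w.
have f1le x : unit_ball x -> rnorm (f1 x) <= rnorm f + t.
  move=> Bx; rewrite (le_trans (rnormD _ _))// rnormZr ?(ltW t0)// w1 mulr1.
  by rewrite lerD2r nl.
have f1x0 : rnorm (f1 x0) = rnorm (f x0) + t.
  rewrite /f1 {1}fw -scalerDl -rmorphD /= rnormZr ?w1 ?mulr1//.
  by rewrite addr_ge0 ?rnorm_ge0// ltW.
pose Q x := rnorm x `^ p.
have Q0 x : 0 <= Q x by exact: powR_ge0.
have Q1 x : unit_ball x -> Q x <= 1.
  by move=> Bx; have := ler_powRl p0 (rnorm_ge0 x) Bx; rewrite powR1.
have sd : 0 < s * (d / 4) by rewrite mulr_gt0// divr_gt0.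
have [|x1 Bx1 hx1] := @almost_max R X unit_ball (fun x => rnorm (f1 x) + s * Q x)
    (rnorm f + t + s) (s * (d / 4)) B0 _ sd.
  by move=> x Bx; rewrite lerD ?f1le// ler_piMr ?Q1// ltW.
have [psi psile psigrad] := powR_norm_gradient Bx1.
have psiB x : unit_ball x -> rnorm (psi x) <= p.
  by move=> Bx; rewrite (le_trans (psile x))// ler_piMr// ltW.
have [h ah hE] := affine_fun_ex k (affine_pert_rank1 t%:C (s%:C *: psi) w).
have gE x : unit_ball x -> (f + h) x = f1 x + (s%:C * psi x) *: w.
  by move=> Bx; rewrite ball_addE hE// scalerDl addrA dual_scaleE.
(* As [y w] has modulus at most 1, the square of its distance to 1 is at most twice [1 - Re (y w)],
   hence below [2 * q = s0 ^+ 2]. *)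
have near1 (y : dual X) : (forall x, rnorm (y x) <= rnorm x) ->
    1 - q < complex.Re (y w) -> rnorm (y w - 1 : R[i]^o) <= s0.
  move=> yle yw; rewrite -(@ler_pXn2r _ 2) ?nnegrE ?rnorm_ge0 ?(ltW s00)//.
  have yw1 : rnorm (y w) ^+ 2 <= 1 by rewrite exprn_ile1 ?rnorm_ge0// -w1 yle.
  move: yw1; rewrite !sqr_rnorm.
  have : s0 ^+ 2 = 2 * q by rewrite /q; field.
  move: yw; case: (y w) => a b /=; rewrite oppr0 addr0 => yw -> ab; nra.
have Repsi (y : dual X) x : unit_ball x -> rnorm (y w - 1 : R[i]^o) <= s0 ->
    `|complex.Re (psi x * y w) - complex.Re (psi x)| <= p * s0.
  move=> Bx yw; rewrite -raddfB /= -[X in psi x * y w - X]mulr1 -mulrBr.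
  have bound a : complex.Re a <= rnorm (a : R[i]^o) by exact: Re_le_rnorm.
  have nb : rnorm (psi x * (y w - 1) : R[i]^o) <= p * s0.
    by rewrite rnormM ler_pM ?rnorm_ge0// psiB.
  rewrite ler_norml (le_trans (bound _) nb) andbT lerNl -raddfN /=.
  by rewrite (le_trans (bound _))// rnormN.
have yE (y : dual X) x : y (f1 x) = y (f x) + t%:C * y w by rewrite dualD dualZ.
have Reyf (y : dual X) x : unit_ball x -> (forall x, rnorm (y x) <= rnorm x) ->
    complex.Re (y (f x)) <= rnorm f.
  by move=> Bx yle; rewrite (le_trans (Re_le_rnorm _))// (le_trans (yle _))// nl.
have [y1 y1x y1le] := norming_functional US (f1 x1).
(* [f1 x1] has norm close to [rnorm f + t], of which the part [y1 (f x1)] can supply at most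
   [rnorm f]; so [Re (y1 w)] is close to 1. *)
have y1w : rnorm (y1 w - 1 : R[i]^o) <= s0.
  apply: near1 => //.
  have := congr1 (@complex.Re R) y1x; rewrite yE raddfD /= Re_scale => hy.
  have := Reyf y1 x1 Bx1 y1le.
  have := hx1 x0 Bx0; rewrite f1x0; have := Q0 x0; have := Q1 x1 Bx1.
  have : m = t * q / 4 by [].
  move: (Q x0) (Q x1) => a b b1 a0.
  rewrite -(ltr_pM2l t0); nra.
have gx1 : rnorm (f1 x1) + s * complex.Re (psi x1) - s * (p * s0) <= rnorm ((f + h) x1).
  have : complex.Re (y1 ((f + h) x1)) <= rnorm ((f + h) x1).
    by rewrite (le_trans (Re_le_rnorm _))// y1le.
  apply: le_trans; rewrite gE// dualD dualZ y1x raddfD /= -mulrA Re_scale.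
  have := Repsi y1 x1 Bx1 y1w; rewrite ler_norml => /andP[h1 _]; nra.
have psix0 := psiB x0 Bx0.
exists h; split=> //.
  apply: (@le_lt_trans _ _ (t + s * p)); last by rewrite /t in s2 *; lra.
  apply: (@ball_algebra_norm_le R X k h) => x Bx; rewrite hE// rnormZ w1 mulr1 (le_trans (rnormD _ _))//.
  rewrite rnorm_real ger0_norm ?(ltW t0)// lerD2l dual_scaleE rnormM rnorm_real.
  by rewrite ger0_norm ?(ltW ss0)// ler_wpM2l ?(ltW ss0)// psiB.
apply: (@small_slice_center _ _ _ _ _ (s * (d / 4)) _ x1) => // x Bx.
rewrite slice_sup_norm /norm_val => hx; apply: hd => //.
have [y yx yle] := norming_functional US ((f + h) x).
have gy : rnorm ((f + h) x) =
    complex.Re (y (f1 x)) + s * complex.Re (psi x * y w).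
  by have := congr1 (@complex.Re R) yx; rewrite gE// dualD dualZ raddfD /= -mulrA Re_scale => <-.
have gx0 : rnorm (f x0) + t - s * p <= rnorm (f + h).
  apply: le_trans (nl _ x0 Bx0); rewrite gE// -f1x0.
  have := rnorm_le_dist (f1 x0) (- ((s%:C * psi x0) *: w)).
  rewrite opprK rnormN rnormZ w1 mulr1 rnormM rnorm_real ger0_norm ?(ltW ss0)//.
  apply: le_trans; rewrite lerB// ler_wpM2l// ltW//.
have yw : rnorm (y w - 1 : R[i]^o) <= s0.
  apply: near1 => //.
  have := gy; rewrite yE raddfD /= Re_scale => hy.
  have := Reyf y x Bx yle.
  have : complex.Re (psi x * y w) <= p.
    rewrite (le_trans (Re_le_rnorm _))// rnormM -[leRHS]mulr1.
    by rewrite ler_pM ?rnorm_ge0 ?psiB// -w1 yle.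
  have : m = t * q / 4 by [].
  rewrite -(ltr_pM2l t0); nra.
have gx : rnorm ((f + h) x) <= rnorm (f1 x) + s * complex.Re (psi x) + s * (p * s0).
  rewrite gy; have := Repsi y x Bx yw; rewrite ler_norml => /andP[_ h2].
  have : complex.Re (y (f1 x)) <= rnorm (f1 x).
    by rewrite (le_trans (Re_le_rnorm _))// yle.
  nra.
(* Four errors of [s * (d / 4)] add up: near-maximality of [x1], the slice depth, and [y w] replaced
   by 1 at [x] and at [x1]. With the gradient inequality at the midpoint of [x] and [x1], they bound
   the convexity gap by [d / 2]. *)
have := nl (f + h) x1 Bx1.
have := hx1 x Bx.
have := psigrad ((2^-1)%:C *: (x + x1)).
have -> : (2^-1)%:C *: (x + x1) - x1 = (2^-1)%:C *: (x - x1).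
  rewrite -[X in _ - X](_ : (2^-1)%:C *: (x1 + x1) = x1).
    by rewrite -scalerBr opprD addrACA subrr addr0.
  rewrite scalerDr -scalerDl -rmorphD /= (_ : 2^-1 + 2^-1 = 1) ?scale1r//.
  by field.
rewrite dualZ Re_scale dualB raddfB /= -/(Q _) -/(Q _) -/(Q _).
have : p * s0 = d / 4 by rewrite /s0; field; rewrite gt_eqF.
move=> ps; rewrite ps in gx gx1; move: gx gx1 hx.
move: (Q x) (Q x1) (Q ((2^-1)%:C *: (x + x1))) => a b c.
move: (complex.Re (psi x)) (complex.Re (psi x1)) => P P1.
move: (rnorm ((f + h) x)) (rnorm ((f + h) x1)) (rnorm (f1 x)) (rnorm (f1 x1)) => G G1 F F1.
move=> i1 i2 i3 i4 i5 i6.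
rewrite -(ltr_pM2l ss0); nra.
Qed.

End Density.

(** * Genericity in uniformly convex and uniformly smooth spaces *)

Section AbstractTheorem.
Context {R : realType} {X : normedModType R[i]} (k : ball_class) (p : R).
Hypotheses (p1 : 1 < p) (UC : unif_convex p X) (US : unif_smooth X).
Hypotheses (cX : seq_complete X) (X0 : exists x : X, x != 0).

Let P0 : (@duality_pairs R X) !=set0.
Proof.
have [x x0] := X0.
have [|phi hphi] := norming_pair US (_ : rnorm ((rnorm x)^-1%:C *: x) = 1).
  by rewrite rnormZr ?invr_ge0 ?rnorm_ge0// mulVf// gt_eqF// rnorm_gt0.
by exists ((rnorm x)^-1%:C *: x, phi).
Qed.

Let W n : set (ball_algebra X k) :=
  small_slice unit_ball norm_val id n.+1%:R^-1 `&`
  small_slice duality_pairs pair_val fst n.+1%:R^-1.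

Let Wopen n : open (W n).
Proof.
apply: openI; apply: open_small_slice.
- by exists 0; exact: unit_ball0.
- exact: ball_algebra_le.
- exact: norm_val_lip.
- exact: P0.
- exact: pair_val_le.
- exact: pair_val_lip.
Qed.

Lemma peak_functions_bigcap :
  [set f : ball_algebra X k | norm_strong_peak f /\ numerical_strong_peak f] =
  \bigcap_n W n.
Proof.
have nP f := @peaks_atP R (ball_algebra X k) X X unit_ball norm_val id
  (ex_intro _ _ unit_ball0) ball_algebra_le f cX.
have pP f := @peaks_atP R (ball_algebra X k) X _ duality_pairs pair_val fst
  P0 pair_val_le f cX.
apply/seteqP; split=> f /=.
  move=> [/norm_strong_peakP/nP h1 /(numerical_strong_peakP US _ P0)/pP h2] n _.
  by split; [exact: h1|exact: h2].
move=> h; split.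
  by apply/norm_strong_peakP/nP => n; have [] := h n I.
by apply/(numerical_strong_peakP US _ P0)/pP => n; have [] := h n I.
Qed.

Theorem strong_peak_functions_generic :
  let S : set (ball_algebra X k) :=
    [set f | norm_strong_peak f /\ numerical_strong_peak f] in
  [/\ Gdelta S, dense S &
      forall f : ball_algebra X k,
        numerical_strong_peak f -> very_strong_numerical_peak f].
Proof.
move=> S; rewrite /S peak_functions_bigcap; split.
- by exists W.
- apply: (@baire_relative _ _ (@affine_fun R X k)) => //.
  + exact: affine_fun0.
  + by move=> g h; exact: affine_funD.
  + by move=> u uC; exact: affine_increments_cvg.
  + move=> n f r r0; have e0 : 0 < n.+1%:R^-1 :> R by rewrite invr_gt0.
    (* First [g] makes the norm slice small. This survives perturbations below some [q], so the
       second one, for the numerical radius, is taken smaller than both [q] and [r / 2]. *)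
    have [|g [ag gr gW]] := small_slice_norm_dense p1 UC US f X0 (_ : 0 < r / 2) e0.
      by rewrite divr_gt0.
    have /open_rnormP/(_ _ gW)[q q0 hq] : open (small_slice unit_ball
        (@norm_val R X k) id n.+1%:R^-1).
      apply: open_small_slice; first by exists 0; exact: unit_ball0.
        exact: ball_algebra_le.
      exact: norm_val_lip.
    have m0 : 0 < Num.min (r / 2) q by rewrite lt_min q0 divr_gt0.
    have [h [ah hr hW]] := small_slice_pair_dense p1 UC (f + g) P0 m0 e0.
    move: hr; rewrite lt_min => /andP[hr hq'].
    exists (g + h); split; first exact: affine_funD.
      by rewrite (le_lt_trans (rnormD _ _))//; lra.
    rewrite addrA; split=> //; apply: hq.
    by rewrite [f + g + h]addrC addrK.
- by move=> f; exact: numerical_very_strong.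
Qed.

End AbstractTheorem.

(** * Convexity and smoothness of [|.|^p] on the complex numbers *)

Section Scalar.
Context {R : realType}.
Implicit Types (a b h y z : R[i]).

Local Notation cn x := (rnorm (x : R[i]^o)).

(** Let [M] be the midpoint of [t] and 1, and [w] that of [M] and 1. Tangents at [M], evaluated at
    [t] and [w], and at [w], evaluated at 1, leave a gap proportional to the difference of the
    slopes at [w] and [M]. It is bounded below because [w / M] is at least [r > 1] and [M] at least
    1/2. This treats all [p > 1] alike. *)
Lemma powR_midpoint_gap (p k : R) : 1 < p -> 0 <= k -> k < 1 -> exists2 c : R, 0 < c &
  forall t, 0 <= t -> t <= k -> c <= (1 + t `^ p) / 2 - ((1 + t) / 2) `^ p.
Proof.
move=> p1 k0 k1; have pm : 0 < p - 1 by lra.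
pose r := (3 + k) / (2 + 2 * k).
have r1 : 1 < r by rewrite ltr_pdivlMr; lra.
have rp : 1 < r `^ (p - 1).
  have := @gt0_ltr_powR R _ pm 1 r; rewrite powR1 !nnegrE ler01 ltW ?(lt_trans ltr01 r1)//.
  by apply.
pose s : R := 2^-1 `^ (p - 1).
have s0 : 0 < s by rewrite powR_gt0// invr_gt0.
exists (p * (1 - k) / 8 * ((r `^ (p - 1) - 1) * s)).
  by rewrite mulr_gt0// ?mulr_gt0 ?subr_gt0//; lra.
move=> t t0 tk.
pose M := (1 + t) / 2; pose w := (3 + t) / 4.
have M0 : 0 <= M by rewrite /M; lra.
have w0 : 0 <= w by rewrite /w; lra.
have h1 := powR_tangent p1 ler01 w0; rewrite powR1 in h1.
have h2 := powR_tangent p1 w0 M0.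
have h3 := powR_tangent p1 t0 M0.
have hw : r `^ (p - 1) * M `^ (p - 1) <= w `^ (p - 1).
  rewrite -powRM//; last by rewrite /r divr_ge0//; lra.
  apply: ler_powRl => //.
    by rewrite mulr_ge0// divr_ge0//; lra.
  rewrite /r mulrAC ler_pdivrMr; last by lra.
  by rewrite /M /w; nra.
have hM : s <= M `^ (p - 1).
  by apply: ler_powRl; rewrite ?invr_ge0//; rewrite /M; lra.
rewrite -/M.
have e1 : 1 - w = (1 - t) / 4 by rewrite /w; field.
have e2 : w - M = (1 - t) / 4 by rewrite /w /M; field.
have e3 : t - M = - ((1 - t) / 2) by rewrite /M; field.
rewrite e1 in h1; rewrite e2 in h2; rewrite e3 in h3.
move: h1 h2 h3 hw hM rp.
move: (r `^ (p - 1)) (M `^ (p - 1)) (w `^ (p - 1)) (M `^ p) (w `^ p) (t `^ p).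
move=> rq Mq wq Mp wp tp h1 h2 h3 hw hM rp.
have h4 : (rq - 1) * s <= wq - Mq.
  have : (rq - 1) * s <= (rq - 1) * Mq by rewrite ler_wpM2l// subr_ge0 ltW.
  lra.
have h5 : p * (1 - k) / 8 * ((rq - 1) * s) <= p * (1 - t) / 8 * (wq - Mq).
  apply: ler_pM => //.
  - by rewrite !mulr_ge0//; lra.
  - by rewrite mulr_ge0 ?(ltW s0)//; lra.
  - by rewrite ler_pM2r// ler_wpM2l//; lra.
apply: (le_trans h5); lra.
Qed.

Lemma rnorm_parallelogram a b :
  (cn (a + b)) ^+ 2 + (cn (a - b)) ^+ 2 = 2 * ((cn a) ^+ 2 + (cn b) ^+ 2).
Proof. by rewrite !sqr_rnorm; case: a b => x y [u v] /=; ring. Qed.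

Lemma rnorm_half a : (cn ((2^-1)%:C * a)) = 2^-1 * (cn a).
Proof. by rewrite rnormM rnorm_real ger0_norm// invr_ge0. Qed.

Lemma powR_rnorm_midpoint (p : R) a b : 1 < p ->
  (cn ((2^-1)%:C * (a + b))) `^ p <= ((cn a) `^ p + (cn b) `^ p) / 2.
Proof.
move=> p1; rewrite rnorm_half.
have M0 : 0 <= ((cn a) + (cn b)) / 2 by rewrite divr_ge0// addr_ge0 ?rnorm_ge0.
apply: (@le_trans _ _ ((((cn a) + (cn b)) / 2) `^ p)).
  apply: ler_powRl; [lra|by rewrite mulr_ge0 ?invr_ge0 ?rnorm_ge0|].
  by rewrite mulrC ler_pM2r ?invr_gt0// rnormD.
have := powR_tangent p1 (rnorm_ge0 (a : R[i]^o)) M0.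
have := powR_tangent p1 (rnorm_ge0 (b : R[i]^o)) M0.
move: (_ `^ (p - 1)) => q; lra.
Qed.

(** If the modulus of [b] is at most [k] times that of [a], the moduli alone give the gap. Otherwise
    the parallelogram law bounds the midpoint by [k] times the modulus of [a], while [b] contributes
    at least the p-th power of [k]. *)
Lemma rnorm_midpoint_gap (p s : R) : 1 < p -> 0 < s -> exists2 c : R, 0 < c &
  forall a b, (cn b) <= (cn a) -> s * (cn a) <= (cn (a - b)) ->
    c * (cn a) `^ p <= ((cn a) `^ p + (cn b) `^ p) / 2 - (cn ((2^-1)%:C * (a + b))) `^ p.
Proof.
move=> p1 s0; have p0 : 0 < p by lra.
(* This factor comes from the parallelogram law; for [s > 2] the radicand is negative and the square
   root is 0 by default. *)
pose k := Num.sqrt (1 - s ^+ 2 / 4).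
have k0 : 0 <= k by exact: sqrtr_ge0.
have k1 : k < 1.
  have [hs|hs] := lerP (1 - s ^+ 2 / 4) 0; first by rewrite /k ler0_sqrtr// ltr01.
  rewrite -(@ltr_pXn2r _ 2) ?nnegrE// expr1n /k sqr_sqrtr ?(ltW hs)//.
  have : 0 < s ^+ 2 by rewrite exprn_gt0.
  lra.
have kp : k `^ p < 1.
  by have := @gt0_ltr_powR R _ p0 k 1; rewrite powR1 !nnegrE ler01 k0; exact.
have [c c0 hc] := powR_midpoint_gap p1 k0 k1.
exists (Num.min c ((1 - k `^ p) / 2)) => [|a b ba sab].
  by rewrite lt_min c0 divr_gt0// subr_gt0.
have [A0|A0] := eqVneq (cn a) 0.
  have -> : a = 0 by exact: (@rnorm_eq0 _ (R[i]^o)).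
  have -> : b = 0.
    by apply: (@rnorm_eq0 _ (R[i]^o)); apply/eqP; rewrite eq_le rnorm_ge0 andbT -A0.
  by rewrite addr0 mulr0 rnorm0 powR0 ?gt_eqF// mulr0 addr0 mul0r subr0.
have Ap : 0 < (cn a) by rewrite lt_neqAle eq_sym A0 rnorm_ge0.
pose t := (cn b) / (cn a).
have t0 : 0 <= t by rewrite divr_ge0 ?rnorm_ge0.
have bE : (cn b) = (cn a) * t by rewrite /t mulrCA divff ?mulr1.
have App : 0 <= (cn a) `^ p by exact: powR_ge0.
have nm : (cn ((2^-1)%:C * (a + b))) <= (cn a) * ((1 + t) / 2).
  rewrite rnorm_half.
  have -> : (cn a) * ((1 + t) / 2) = 2^-1 * ((cn a) + (cn b)) by rewrite bE; ring.
  by rewrite ler_pM2l ?invr_gt0// rnormD.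
rewrite bE powRM ?rnorm_ge0//.
have [tk|kt] := lerP t k.
  have h1 : (cn ((2^-1)%:C * (a + b))) `^ p <= (cn a) `^ p * ((1 + t) / 2) `^ p.
    rewrite -powRM ?rnorm_ge0//; last by lra.
    by apply: ler_powRl; rewrite ?mulr_ge0 ?rnorm_ge0//; lra.
  have h2 := hc t t0 tk.
  apply: (@le_trans _ _ (c * (cn a) `^ p)); first by rewrite ler_wpM2r// ge_min lexx.
  have : (cn a) `^ p * c <= (cn a) `^ p * ((1 + t `^ p) / 2 - ((1 + t) / 2) `^ p).
    by rewrite ler_wpM2l.
  lra.
have h1 : (cn ((2^-1)%:C * (a + b))) <= k * (cn a).
  have para := rnorm_parallelogram a b.
  have sab2 : s ^+ 2 * (cn a) ^+ 2 <= (cn (a - b)) ^+ 2.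
    by rewrite -exprMn ler_pXn2r ?nnegrE ?mulr_ge0 ?rnorm_ge0// ltW.
  have b2 : (cn b) ^+ 2 <= (cn a) ^+ 2 by rewrite ler_pXn2r ?nnegrE ?rnorm_ge0.
  have m2 : (cn ((2^-1)%:C * (a + b))) ^+ 2 <= (1 - s ^+ 2 / 4) * (cn a) ^+ 2.
    rewrite rnorm_half exprMn.
    have -> : (2^-1 : R) ^+ 2 = 4^-1 by rewrite expr2; field.
    lra.
  have hs : 0 <= 1 - s ^+ 2 / 4.
    have := le_trans (sqr_ge0 _) m2; rewrite pmulr_lge0// exprn_gt0//.
  rewrite -(@ler_pXn2r _ 2) ?nnegrE ?mulr_ge0 ?rnorm_ge0//.
  by rewrite exprMn /k sqr_sqrtr.
have h2 : (cn ((2^-1)%:C * (a + b))) `^ p <= k `^ p * (cn a) `^ p.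
  rewrite -powRM ?rnorm_ge0//.
  by apply: ler_powRl; rewrite ?rnorm_ge0.
have h3 : k `^ p <= t `^ p by apply: ler_powRl => //; exact: ltW.
apply: (@le_trans _ _ ((1 - k `^ p) / 2 * (cn a) `^ p)).
  by rewrite ler_wpM2r// ge_min lexx orbT.
have : (cn a) `^ p * k `^ p <= (cn a) `^ p * t `^ p by rewrite ler_wpM2l.
lra.
Qed.

(** When [a - b] is small relative to [a], the first term suffices; otherwise the gap dominates a
    multiple of the p-th power of [2 |a|]. The inequality is linear in p-th powers, so it can be
    integrated. *)
Lemma rnorm_unif_convex (p e : R) : 1 < p -> 0 < e -> exists2 C : R, 0 <= C &
  forall a b, (cn (a - b)) `^ p <= e * ((cn a) `^ p + (cn b) `^ p) +
    C * (((cn a) `^ p + (cn b) `^ p) / 2 - (cn ((2^-1)%:C * (a + b))) `^ p).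
Proof.
move=> p1 e0; have p0 : 0 < p by lra.
have s0 : 0 < e `^ p^-1 by exact: powR_gt0.
have [c c0 hc] := rnorm_midpoint_gap p1 s0.
have C0 : 0 <= 2 `^ p / c by rewrite divr_ge0 ?powR_ge0// ltW.
exists (2 `^ p / c) => // a b.
wlog ba : a b / (cn b) <= (cn a).
  move=> h; have [/h//|/ltW/h] := lerP (cn b) (cn a).
  by rewrite (rnormBC (b : R[i]^o)) [b + a]addrC [_ `^ p + _ `^ p]addrC.
have D0 : 0 <= ((cn a) `^ p + (cn b) `^ p) / 2 - (cn ((2^-1)%:C * (a + b))) `^ p.
  by rewrite subr_ge0 powR_rnorm_midpoint.
have [sab|sab] := lerP (e `^ p^-1 * (cn a)) (cn (a - b)).
  have h := hc a b ba sab.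
  rewrite -[leLHS]add0r; apply: lerD.
    by rewrite mulr_ge0 ?addr_ge0 ?powR_ge0// ltW.
  apply: (@le_trans _ _ (2 `^ p * (cn a) `^ p)).
    rewrite -powRM ?rnorm_ge0//.
    apply: ler_powRl; rewrite ?rnorm_ge0//.
    by have := rnormB (a : R[i]^o) (b : R[i]^o); lra.
  rewrite -mulrA ler_wpM2l ?powR_ge0// mulrC ler_pdivlMr// mulrC //.
rewrite -[leLHS]addr0; apply: lerD; last exact: mulr_ge0.
apply: (@le_trans _ _ (e * (cn a) `^ p)).
  have eE : e = (e `^ p^-1) `^ p by rewrite -powRrM mulVf ?gt_eqF// powRr1// ltW.
  rewrite [X in X * _]eE.
  rewrite -powRM ?rnorm_ge0 ?powR_ge0//.
  by apply: ler_powRl; rewrite ?rnorm_ge0// ltW.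
by rewrite ler_wpM2l ?(ltW e0)// lerDl powR_ge0.
Qed.

Lemma rnormD_powR (p : R) a b : 1 < p ->
  (cn (a + b)) `^ p <= 2 `^ p * ((cn a) `^ p + (cn b) `^ p).
Proof.
move=> p1; have p0 : 0 < p by lra.
wlog ba : a b / (cn b) <= (cn a).
  move=> h; have [/h//|/ltW/h] := lerP (cn b) (cn a).
  by rewrite [b + a]addrC [_ `^ p + _ `^ p]addrC.
apply: (@le_trans _ _ (2 `^ p * (cn a) `^ p)).
  rewrite -powRM ?rnorm_ge0//.
  apply: ler_powRl; rewrite ?rnorm_ge0//.
  by have := rnormD (a : R[i]^o) (b : R[i]^o); lra.
by rewrite ler_wpM2l ?powR_ge0// lerDl powR_ge0.
Qed.

(** The equality case of [young_Re]. *)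
Lemma powR_rnorm_dual (p : R) z : 1 < p -> exists2 y,
  complex.Re (z * y) = (cn z) `^ p & (cn y) `^ (p / (p - 1)) = (cn z) `^ p.
Proof.
move=> p1; have pm : 0 < p - 1 by lra.
have [c c1 cz] := unit_phaseV z.
exists (((cn z) `^ (p - 1))%:C * c).
  rewrite mulrCA [z * c]mulrC cz -rmorphM /=.
  by rewrite mulrC mulr_powRB1 ?rnorm_ge0//; lra.
rewrite rnormM c1 mulr1 rnorm_real ger0_norm ?powR_ge0// -powRrM.
by congr (_ `^ _); field; rewrite gt_eqF.
Qed.

Lemma young_Re (p : R) a y : 1 < p ->
  p * complex.Re (a * y) <= (cn a) `^ p + (p - 1) * (cn y) `^ (p / (p - 1)).
Proof.
move=> p1; have p0 : 0 < p by lra.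
have pm : 0 < p - 1 by lra.
have := @conjugate_powR R (cn a) (cn y) p (p / (p - 1)) (rnorm_ge0 _) (rnorm_ge0 _) p0
  (divr_gt0 p0 pm).
have -> : p^-1 + (p / (p - 1))^-1 = 1 by field; rewrite !gt_eqF.
move=> /(_ erefl); rewrite -rnormM => h.
have -> : (cn a) `^ p + (p - 1) * (cn y) `^ (p / (p - 1)) =
    p * ((cn a) `^ p / p + (cn y) `^ (p / (p - 1)) / (p / (p - 1))).
  by field; rewrite !gt_eqF.
by rewrite ler_pM2l// (le_trans (Re_le_rnorm _)).
Qed.

(* Uniform smoothness of [|.|^p] is obtained from uniform convexity of [|.|^q]:
   by Young's inequality, |.|^p is a supremum of affine functions whose
   intercepts are multiples of [|.|^q]. *)
Lemma rnorm_unif_smooth (p e : R) : 1 < p -> 0 < e -> exists2 t : R, 0 < t &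
  forall a h, (cn (a + t%:C * h)) `^ p + (cn (a - t%:C * h)) `^ p <=
    2 * (cn a) `^ p + e * t * ((cn a) `^ p + (cn h) `^ p).
Proof.
move=> p1 e0; have p0 : 0 < p by lra.
have pm : 0 < p - 1 by lra.
pose q := p / (p - 1).
have q0 : 0 < q by rewrite divr_gt0.
have q1 : 1 < q by rewrite /q ltr_pdivlMr//; lra.
have pq : p^-1 + q^-1 = 1 by rewrite /q; field; rewrite !gt_eqF.
(* Young's inequality will be applied to [m |h|] and [|y - z| / m]: this [m] gives the power of
   [|h|] the coefficient [e / 2], and [L] is the resulting coefficient of the power of [|y - z|]. *)
pose m := (e / 2) `^ p^-1.
have m0 : 0 < m by rewrite powR_gt0// divr_gt0.
have mp : m `^ p = e / 2.
  by rewrite /m -powRrM mulVf ?gt_eqF// powRr1// divr_ge0// ltW.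
pose L := p * (m^-1 `^ q / q).
have L0 : 0 < L by rewrite mulr_gt0// divr_gt0// powR_gt0// invr_gt0.
pose W : R := 2 * 2 `^ p.
have W0 : 0 < W by rewrite mulr_gt0// powR_gt0.
have LE : L = p * (m^-1 `^ q / q) by [].
have WE : W = 2 * 2 `^ p by [].
clearbody L W.
have LW0 : 0 < 2 * L * W by rewrite !mulr_gt0.
have [|C C0 hC] := rnorm_unif_convex q1 (_ : 0 < e / (2 * L * W)); first by rewrite divr_gt0.
(* [t * (L * C) <= 2 * (p - 1)] lets the gap [D] of [y] and [z] be absorbed by the term
   [- 2 * (p - 1) * D], which appears when [young_Re] is used at the midpoint of [y] and [z]. *)
pose t := Num.min 1 (2 * (p - 1) / (L * C + 1)).
have LC : 0 < L * C + 1 by rewrite ltr_wpDl// mulr_ge0// ltW.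
have t0 : 0 < t by rewrite lt_min ltr01 divr_gt0// mulr_gt0.
have t1 : t <= 1 by rewrite ge_min lexx.
have tL : t * (L * C) <= 2 * (p - 1).
  have : t * (L * C + 1) <= 2 * (p - 1) by rewrite -ler_pdivlMr// ge_min lexx orbT.
  lra.
clearbody t.
exists t => // a h.
have [y yRe yn] := powR_rnorm_dual (a + t%:C * h) p1.
have [z zRe zn] := powR_rnorm_dual (a - t%:C * h) p1.
rewrite -/q in yn zn.
have th : (cn (t%:C * h)) `^ p <= (cn h) `^ p.
  apply: ler_powRl; rewrite ?rnorm_ge0//.
  by rewrite rnormM rnorm_real ger0_norm ?(ltW t0)// ler_piMl ?rnorm_ge0.
have yz : (cn y) `^ q + (cn z) `^ q <= W * ((cn a) `^ p + (cn h) `^ p).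
  rewrite yn zn.
  have h1 := rnormD_powR a (t%:C * h) p1; have h2 := rnormD_powR a (- (t%:C * h)) p1.
  rewrite (rnormN (t%:C * h : R[i]^o)) in h2.
  have : 2 `^ p * ((cn a) `^ p + (cn (t%:C * h)) `^ p) <= 2 `^ p * ((cn a) `^ p + (cn h) `^ p).
    by rewrite ler_wpM2l ?powR_ge0// lerD2l.
  rewrite WE; lra.
have D0 := powR_rnorm_midpoint y z q1.
have := young_Re a ((2^-1)%:C * (y + z)) p1.
rewrite -/q mulrCA Re_scale mulrDr raddfD /= => yg.
have hyz : p * complex.Re (h * (y - z)) <= e / 2 * (cn h) `^ p + L * (cn (y - z)) `^ q.
  have m'0 : 0 <= m^-1 by rewrite invr_ge0 ltW.
  have := @conjugate_powR R (m * (cn h)) (m^-1 * (cn (y - z))) p q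
    (mulr_ge0 (ltW m0) (rnorm_ge0 _)) (mulr_ge0 m'0 (rnorm_ge0 _)) p0 q0 pq.
  rewrite !powRM ?rnorm_ge0 ?(ltW m0)// mp.
  have -> : m * (cn h) * (m^-1 * (cn (y - z))) = (cn (h * (y - z))).
    by rewrite rnormM; field; rewrite gt_eqF.
  move=> yo.
  have : p * complex.Re (h * (y - z)) <=
      p * (e / 2 * (cn h) `^ p / p + m^-1 `^ q * (cn (y - z)) `^ q / q).
    by rewrite ler_pM2l// (le_trans (Re_le_rnorm _)).
  move=> /le_trans; apply; rewrite le_eqVlt; apply/orP; left; apply/eqP.
  by rewrite LE; field; rewrite !gt_eqF.
rewrite mulrDl -mulrA raddfD /= Re_scale in yRe.
rewrite mulrDl mulNr -mulrA raddfB /= Re_scale in zRe.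
have := hC y z; move: yRe zRe.
have : complex.Re (h * (y - z)) = complex.Re (h * y) - complex.Re (h * z).
  by rewrite mulrBr raddfB.
move: hyz => /[swap] -> hyz.
have eL : L * (e / (2 * L * W)) * W = e / 2 by field; rewrite !gt_eqF.
move: yn zn yz D0 yg hyz; rewrite -/q.
move: (complex.Re (h * y)) (complex.Re (h * z)) (complex.Re (a * y)) (complex.Re (a * z)).
move: ((cn y) `^ q) ((cn z) `^ q) ((cn (y - z)) `^ q) ((cn ((2^-1)%:C * (y + z))) `^ q).
move: ((cn (a + t%:C * h)) `^ p) ((cn (a - t%:C * h)) `^ p).
have hp := powR_ge0 (cn h) p; have ap := powR_ge0 (cn a) p.
move: hp ap; move: ((cn a) `^ p) ((cn h) `^ p) => ap hp hp0 ap0.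
move=> P M Y Z E N hy hz ay az yn zn yz D0 yg hyz yRe zRe hYZ.
set D := (Y + Z) / 2 - N in hYZ.
have D0' : 0 <= D by rewrite subr_ge0.
have s1 : P + M = p * (ay + az) + p * (t * (hy - hz)) - (p - 1) * (Y + Z).
  rewrite yn zn -yRe -zRe; ring.
have s2 : t * (p * (hy - hz)) <= t * (e / 2 * hp + L * E) by rewrite ler_wpM2l// ltW.
have s3 : t * (L * E) <= t * (L * (e / (2 * L * W) * (Y + Z) + C * D)).
  by rewrite !ler_pM2l.
have s4 : t * (L * C) * D <= 2 * (p - 1) * D by rewrite ler_wpM2r.
have s5 : t * (L * (e / (2 * L * W))) * (Y + Z) <=
    t * (L * (e / (2 * L * W))) * (W * (ap + hp)).
  apply: ler_wpM2l => //; apply: mulr_ge0; first exact: ltW.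
  by apply: mulr_ge0; [exact: ltW|rewrite divr_ge0// ltW].
have s6 : t * (L * (e / (2 * L * W))) * (W * (ap + hp)) = t * (e / 2) * (ap + hp).
  by rewrite -eL; ring.
have s7 : 0 <= t * (e / 2) * ap.
  by apply: mulr_ge0 => //; apply: mulr_ge0; [exact: ltW|rewrite divr_ge0// ltW].
rewrite /D in s3 s4 *.
lra.
Qed.

End Scalar.

(** * The space L_p *)

Section LpSpace.
Context (R : realType) (d : measure_display) (T : measurableType d).
Context (mu : {measure set T -> \bar R}) (p : R) (p1 : 1 < p).

Local Notation X := (cLspace mu (ltW p1)).
Local Notation F := (cLfun mu (ltW p1)).
Local Open Scope quotient_scope.
Implicit Types (x y : X) (f g : F).

Let p0 : 0 < p. Proof. exact: lt_trans p1. Qed.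

Lemma measurable_rnorm (f : T -> R[i]^o) :
  measurable_fun [set: T] (fun t => complex.Re (f t)) ->
  measurable_fun [set: T] (fun t => complex.Im (f t)) ->
  measurable_fun [set: T] (fun t => rnorm (f t)).
Proof.
move=> mr mi.
rewrite (_ : (fun t => rnorm (f t)) =
  (@powR R ^~ 2^-1) \o (fun t => complex.Re (f t) ^+ 2 + complex.Im (f t) ^+ 2)).
  apply: measurableT_comp; first exact: measurable_powR.
  by apply: measurable_funD; apply: measurable_funX.
by apply/funext => t /=; rewrite powR12_sqrt ?addr_ge0 ?sqr_ge0// /rnorm normc_def.
Qed.

Lemma cLfun_meas_Re f : measurable_fun [set: T] (fun t => complex.Re (f t)).
Proof. by have := cLfun_funP f; rewrite inE => -[]. Qed.

Lemma cLfun_meas_Im f : measurable_fun [set: T] (fun t => complex.Im (f t)).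
Proof. by have := cLfun_funP f; rewrite inE => -[]. Qed.

Lemma cLfun_meas_powR f :
  measurable_fun [set: T] (fun t => (rnorm (f t) `^ p)%:E).
Proof.
apply/measurable_EFinP; apply: (measurableT_comp (measurable_powR _)).
by apply: measurable_rnorm; [exact: cLfun_meas_Re|exact: cLfun_meas_Im].
Qed.

Lemma powR_cLnorm (f : T -> R[i]^o) :
  ('N[mu]_p%:E[EFin \o (fun t => rnorm (f t))] `^ p)%E =
  (\int[mu]_t (rnorm (f t) `^ p)%:E)%E.
Proof.
rewrite unlock /Lnorm -poweRrM mulVf ?gt_eqF// poweRe1; last first.
  by apply: integral_ge0 => t _; rewrite lee_fin powR_ge0.
by apply: eq_integral => t _; rewrite /= ger0_norm ?rnorm_ge0.
Qed.

Lemma cLnorm_fin f : ('N[mu]_p%:E[EFin \o (fun t => rnorm (f t))])%E \is a fin_num.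
Proof.
have := cLfun_funP f; rewrite inE => -[_ _ h].
by rewrite ge0_fin_numE// Lnorm_ge0.
Qed.

Lemma powR_rnorm_repr x :
  ((rnorm x `^ p)%:E = \int[mu]_t (rnorm (repr x t) `^ p)%:E)%E.
Proof. by rewrite cLspace_rnormE -poweR_EFin fineK ?cLnorm_fin// powR_cLnorm. Qed.

Lemma powR_rnorm_ae x f : {ae mu, forall t, repr x t = f t} ->
  ((rnorm x `^ p)%:E = \int[mu]_t (rnorm (f t) `^ p)%:E)%E.
Proof.
move=> xf; rewrite powR_rnorm_repr; apply: ae_eq_integral => //.
- exact: cLfun_meas_powR.
- exact: cLfun_meas_powR.
- by apply: filterS xf => t -> _.
Qed.

Lemma repr_pi_ae f : {ae mu, forall t, repr (\pi_X f) t = f t}.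
Proof. by apply/cLspace_eqP; rewrite reprK. Qed.

Lemma repr_add_ae x y : {ae mu, forall t, repr (x + y) t = repr x t + repr y t}.
Proof.
suff -> : x + y = \pi_X (repr x + repr y) by exact: repr_pi_ae.
by rewrite raddfD /= !reprK.
Qed.

Lemma repr_sub_ae x y : {ae mu, forall t, repr (x - y) t = repr x t - repr y t}.
Proof.
suff -> : x - y = \pi_X (repr x - repr y) by exact: repr_pi_ae.
by rewrite raddfB /= !reprK.
Qed.

Lemma repr_scale_ae (a : R[i]) x : {ae mu, forall t, repr (a *: x) t = a * repr x t}.
Proof. exact: (repr_pi_ae (a *: repr x)). Qed.

(** Carries both scalar inequalities over to the norm of [L_p]. All coefficients are nonnegative, so
    negative terms have to be moved to the other side beforehand. *)
Lemma powR_rnorm_comb (c k1 k2 : R) x1 x2 y1 y2 : 0 <= c -> 0 <= k1 -> 0 <= k2 ->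
  {ae mu, forall t, rnorm (repr x1 t) `^ p + c * rnorm (repr x2 t) `^ p <=
    k1 * rnorm (repr y1 t) `^ p + k2 * rnorm (repr y2 t) `^ p} ->
  rnorm x1 `^ p + c * rnorm x2 `^ p <= k1 * rnorm y1 `^ p + k2 * rnorm y2 `^ p.
Proof.
move=> c0 k10 k20 h.
pose P (z : X) t := (rnorm (repr z t) `^ p)%:E.
have P0 z t : [set: T] t -> (0 <= P z t)%E by move=> _; rewrite lee_fin powR_ge0.
have mP z : measurable_fun [set: T] (P z) by exact: cLfun_meas_powR.
have PZ0 (k : R) z : 0 <= k -> forall t, [set: T] t -> (0 <= k%:E * P z t)%E.
  by move=> k0 t Tt; apply: mule_ge0 => //; exact: P0.
have mPZ (k : R) z : measurable_fun [set: T] (fun t => k%:E * P z t)%E.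
  by apply: measurable_funeM; exact: mP.
have combE (k l : R) (y z : X) : 0 <= k -> 0 <= l ->
    (\int[mu]_t (k%:E * P y t + l%:E * P z t) =
     (k * rnorm y `^ p + l * rnorm z `^ p)%:E)%E.
  move=> k0 l0.
  rewrite (ge0_integralD mu measurableT (PZ0 k y k0) (mPZ k y) (PZ0 l z l0) (mPZ l z)).
  rewrite (ge0_integralZl_EFin mu measurableT (P0 y) (mP y) k0).
  rewrite (ge0_integralZl_EFin mu measurableT (P0 z) (mP z) l0).
  by rewrite /P -(powR_rnorm_repr y) -(powR_rnorm_repr z) -!EFinM -EFinD.
rewrite -[X in X + _ <= _]mul1r -lee_fin -(combE 1 c x1 x2 ler01 c0).
rewrite -(combE k1 k2 y1 y2 k10 k20).
apply: ae_ge0_le_integral => //.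
- by move=> t Tt; apply: adde_ge0; exact: PZ0.
- by apply: emeasurable_funD; exact: mPZ.
- by move=> t Tt; apply: adde_ge0; exact: PZ0.
- by apply: emeasurable_funD; exact: mPZ.
- by apply: filterS h => t ht _; rewrite -!EFinM -!EFinD lee_fin mul1r.
Qed.

Lemma cLspace_unif_convex : unif_convex p X.
Proof.
(* The pointwise bound integrates to at most [2 * r] plus [C] times the gap, hence to at most
   [3 * r], which is below [4 * r], the p-th power of [e]. *)
move=> e e0; pose r := e `^ p / 4.
have r0 : 0 < r by rewrite divr_gt0// powR_gt0.
have [C C0 hC] := rnorm_unif_convex p1 r0.
exists (r / (C + 1)) => [|x y Bx By hxy]; first by rewrite divr_gt0// ltr_wpDl.
have rC : 0 <= r + C / 2 by apply: addr_ge0; [exact: ltW|rewrite divr_ge0].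
have := @powR_rnorm_comb C (r + C / 2) (r + C / 2) (x - y) ((2^-1)%:C *: (x + y)) x y
  C0 rC rC.
have hae : {ae mu, forall t, rnorm (repr (x - y) t) `^ p +
    C * rnorm (repr ((2^-1)%:C *: (x + y)) t) `^ p <=
    (r + C / 2) * rnorm (repr x t) `^ p + (r + C / 2) * rnorm (repr y t) `^ p}.
  have h1 := repr_sub_ae x y; have h2 := repr_scale_ae (2^-1)%:C (x + y).
  have h3 := repr_add_ae x y.
  apply: filterS3 h1 h2 h3 => t -> -> ->.
  by have := hC (repr x t) (repr y t); lra.
move=> /(_ hae) h.
have pw (z : X) : unit_ball z -> rnorm z `^ p <= 1.
  by move=> Bz; have := ler_powRl p0 (rnorm_ge0 z) Bz; rewrite powR1.
have hx := pw x Bx; have hy := pw y By.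
move: hxy; rewrite ltr_pdivlMr ?ltr_wpDl// => hxy.
have hlt : rnorm (x - y) `^ p < e `^ p.
  have -> : e `^ p = 4 * r by rewrite /r; field.
  move: hxy h hx hy; move: (rnorm x `^ p) (rnorm y `^ p) (rnorm (x - y) `^ p).
  move: (rnorm ((2^-1)%:C *: (x + y)) `^ p) => m a b z hxy h a1 b1.
  have rab : r * (a + b) <= r * 2 by rewrite ler_wpM2l ?(ltW r0)//; lra.
  have CD : C * ((a + b) / 2 - m) <= r.
    have [D0|/ltW D0] := lerP 0 ((a + b) / 2 - m); first by lra.
    by apply: le_trans (ltW r0); rewrite mulr_ge0_le0.
  lra.
rewrite ltNge; apply/negP => he; move: hlt; rewrite ltNge => /negP; apply.
by apply: ler_powRl => //; exact: ltW.
Qed.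

Lemma cLspace_unif_smooth : unif_smooth X.
Proof.
move=> e e0; have [|t t0 ht] := rnorm_unif_smooth p1 (_ : 0 < e * p / 2).
  by rewrite divr_gt0// mulr_gt0.
exists t => // x h x1 h1.
have et : 0 <= e * p / 2 * t by rewrite mulr_ge0 ?(ltW t0)// divr_ge0// mulr_ge0// ltW.
have := @powR_rnorm_comb 1 (2 + e * p / 2 * t) (e * p / 2 * t)
  (x + t%:C *: h) (x - t%:C *: h) x h ler01 (addr_ge0 (ler0n R 2) et) et.
have hae : {ae mu, forall s, rnorm (repr (x + t%:C *: h) s) `^ p +
    1 * rnorm (repr (x - t%:C *: h) s) `^ p <=
    (2 + e * p / 2 * t) * rnorm (repr x s) `^ p + e * p / 2 * t * rnorm (repr h s) `^ p}.
  have a1 := repr_add_ae x (t%:C *: h); have a2 := repr_sub_ae x (t%:C *: h).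
  have a3 := repr_scale_ae t%:C h.
  apply: filterS3 a1 a2 a3 => s -> -> ->.
  by have := ht (repr x s) (repr h s); lra.
move=> /(_ hae); rewrite x1 powR1 !mulr1 mul1r => hh.
have hp : rnorm h `^ p <= 1.
  by have := ler_powRl p0 (rnorm_ge0 h) h1; rewrite powR1.
(* Tangents at 1 turn the bound on p-th powers into one on norms, at the price of the factor [p]
   built into [e * p / 2]. *)
have t1 := powR_tangent p1 (rnorm_ge0 (x + t%:C *: h)) ler01.
have t2 := powR_tangent p1 (rnorm_ge0 (x - t%:C *: h)) ler01.
rewrite !powR1 mulr1 in t1 t2.
have h3 : e * p / 2 * t * rnorm h `^ p <= e * p / 2 * t by rewrite ler_piMr.
rewrite -(ler_pM2l p0); lra.
Qed.

End LpSpace.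

(** * Completeness of the complex numbers and of [L_p] *)

Lemma normr_Re_le (R : realType) (z : R[i]) :
  `|complex.Re z| <= rnorm (z : R[i]^o).
Proof.
rewrite -(@ler_pXn2r _ 2) ?nnegrE ?rnorm_ge0// real_normK ?num_real//.
by rewrite sqr_rnorm lerDl sqr_ge0.
Qed.

Lemma normr_Im_le (R : realType) (z : R[i]) :
  `|complex.Im z| <= rnorm (z : R[i]^o).
Proof.
rewrite -(@ler_pXn2r _ 2) ?nnegrE ?rnorm_ge0// real_normK ?num_real//.
by rewrite sqr_rnorm lerDr sqr_ge0.
Qed.

Lemma complex_seq_complete (R : realType) : seq_complete (R[i]^o : normedModType R[i]).
Proof.
move=> u uC.
have real_lim (v : nat -> R) : (forall m n, `|v m - v n| <= rnorm (u m - u n)) ->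
    exists l : R, v @ \oo --> l.
  move=> vu; exists (limn v); apply: (@cauchy_cvg R^o).
  apply/cauchy_ballP => e e0; have [N hN] := uC e e0.
  exists (v @` [set n | (N <= n)%N], v @` [set n | (N <= n)%N]).
    by split; exists N => // n /= Nn; exists n.
  move=> [_ _] /= [[m Nm <-] [n Nn <-]]; rewrite -ball_normE /=.
  by apply: (le_lt_trans (vu m n)); exact: hN.
have [|a /cvg_Rseqn ha] := real_lim (fun n => complex.Re (u n)).
  by move=> m n; rewrite -raddfB normr_Re_le.
have [|b /cvg_Rseqn hb] := real_lim (fun n => complex.Im (u n)).
  by move=> m n; rewrite -raddfB normr_Im_le.
exists (a +i* b)%C; apply/cvg_seqP => e e0.
have [|N1 h1] := ha (e / 2); first by rewrite divr_gt0.
have [|N2 h2] := hb (e / 2); first by rewrite divr_gt0.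
exists (maxn N1 N2) => n; rewrite geq_max => /andP[/h1 {}h1 /h2 {}h2].
rewrite -(@ltr_pXn2r _ 2) ?nnegrE ?rnorm_ge0 ?(ltW e0)// sqr_rnorm.
have -> : complex.Re (u n - (a +i* b)%C) = complex.Re (u n) - a by rewrite raddfB.
have -> : complex.Im (u n - (a +i* b)%C) = complex.Im (u n) - b by rewrite raddfB.
move: h1 h2; rewrite !ltr_norml.
by move: (complex.Re (u n) - a) (complex.Im (u n) - b) => r s /andP[? ?] /andP[? ?]; nra.
Qed.

Lemma geometric_increments_cvg (R : realType) (V : normedModType R[i]) (u : nat -> V)
    (s : R) : seq_complete V ->
  (forall n, rnorm (u n.+1 - u n) <= s / 2 ^+ n) ->
  exists2 l : V, u @ \oo --> l & forall n, rnorm (l - u n) <= 2 * s / 2 ^+ n.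
Proof.
move=> cV us.
have s0 : 0 <= s by have := us 0; rewrite expr0 divr1; apply: le_trans; exact: rnorm_ge0.
have bound n k : rnorm (u (n + k)%N - u n) <= 2 * s / 2 ^+ n - 2 * s / 2 ^+ (n + k).
  elim: k => [|k IH]; first by rewrite addn0 !subrr rnorm0.
  rewrite addnS; apply: (le_trans (rnormBD (u (n + k)%N) _ _)).
  have := us (n + k)%N; rewrite exprS invfM.
  move: IH; move: (2 ^+ (n + k))^-1 (2 * s / 2 ^+ n) => w z; lra.
have bound' n k : rnorm (u (n + k)%N - u n) <= 2 * s / 2 ^+ n.
  by apply: (le_trans (bound n k)); rewrite gerBl divr_ge0 ?mulr_ge0 ?exprn_ge0.
have [l ul] : exists l : V, u @ \oo --> l.
  apply: cV => e e0.
  have : 2 * s / 2 ^+ n @[n --> \oo] --> (0 : R).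
    under eq_fun do rewrite -exprVn.
    by apply: (@cvg_geometric R (2 * s) 2^-1); rewrite ger0_norm ?invr_ge0// invf_lt1 // ltr1n.
  move=> /cvg_Rseqn/(_ (e / 2))[|N hN]; first by rewrite divr_gt0.
  have := hN N (leqnn N); rewrite subr0 => hq.
  have eN := le_lt_trans (ler_norm _) hq.
  exists N => m n Nm Nn; apply: (le_lt_trans (rnormBD (u N) _ _)); rewrite (rnormBC (u N)).
  have := bound' N (m - N)%N; have := bound' N (n - N)%N; rewrite !subnKC//; lra.
exists l => // n; apply: (@rnorm_lim_le _ _ (fun k => u k - u n) _ _ n).
  by apply: cvgB => //; exact: cvg_cst.
by move=> k nk; have := bound' n (k - n)%N; rewrite subnKC.
Qed.

Section LpComplete.
Context (R : realType) (d : measure_display) (T : measurableType d).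
Context (mu : {measure set T -> \bar R}) (p : R) (p1 : 1 < p).

Local Notation X := (cLspace mu (ltW p1)).
Local Notation F := (cLfun mu (ltW p1)).
Local Open Scope quotient_scope.

Let p0 : 0 < p. Proof. exact: lt_trans p1. Qed.

(** The factor [2 ^+ k] in the denominator pays for the weight in [g]; the other factors form a
    series with sum 1. *)
Let K (k : nat) : R := (1 / (2 ^ k.+1)%:R) / 2 ^+ k.

Let K_gt0 k : 0 < K k.
Proof. by rewrite !divr_gt0// ?exprn_gt0// ltr0n expn_gt0. Qed.

(* Riesz-Fischer for fast Cauchy sequences: [G] dominates every
   [(2^n |f_(n+1) - f_n|)^p], so that the sequence converges geometrically
   wherever [G] is finite. *)
Lemma cLspace_fast_cvg (v : nat -> X) :
  (forall k, rnorm (v k.+1 - v k) <= K k) -> exists l : X, v @ \oo --> l.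
Proof.
move=> vK.
pose f k : F := repr (v k).
pose D k : F := f k.+1 - f k.
pose g k t := ((2 ^+ k * rnorm (D k t)) `^ p)%:E.
have D_ae k : {ae mu, forall t, repr (v k.+1 - v k) t = D k t} by exact: repr_sub_ae.
have gE k t : g k t = (((2 ^+ k) `^ p)%:E * (rnorm (D k t) `^ p)%:E)%E.
  by rewrite /g powRM ?exprn_ge0 ?rnorm_ge0// EFinM.
have g0 k t : (0 <= g k t)%E by rewrite lee_fin powR_ge0.
have mg k : measurable_fun [set: T] (g k).
  rewrite (_ : g k = fun t => ((2 ^+ k) `^ p)%:E * (rnorm (D k t) `^ p)%:E)%E.
    by apply: measurable_funeM; exact: cLfun_meas_powR.
  by apply/funext => t; exact: gE.
have Ig k : (\int[mu]_t g k t <= 0 + (1 / (2 ^ k.+1)%:R)%:E)%E.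
  under eq_integral => t _ do rewrite gE.
  rewrite ge0_integralZl_EFin ?powR_ge0//; first last.
  - exact: cLfun_meas_powR.
  - by move=> t _; rewrite lee_fin powR_ge0.
  rewrite -(powR_rnorm_ae (D_ae k)) -EFinM add0e lee_fin -powRM ?exprn_ge0 ?rnorm_ge0//.
  have h1 : 2 ^+ k * rnorm (v k.+1 - v k) <= 1 / (2 ^ k.+1)%:R.
    rewrite mulrC -ler_pdivlMr ?exprn_gt0//; exact: vK.
  have h2 : 0 < 1 / (2 ^ k.+1)%:R :> R by rewrite divr_gt0// ltr0n expn_gt0.
  have h3 : 1 / (2 ^ k.+1)%:R <= 1 :> R.
    by rewrite ler_pdivrMr ?ltr0n ?expn_gt0// mul1r ler1n expn_gt0.
  apply: (@le_trans _ _ ((1 / (2 ^ k.+1)%:R) `^ p)).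
    by apply: ler_powRl => //; rewrite mulr_ge0 ?exprn_ge0 ?rnorm_ge0.
  by apply: ge1r_powR; [rewrite h2|exact: ltW].
pose G t := (\sum_(0 <= k <oo) g k t)%E.
have G0 t : (0 <= G t)%E by apply: nneseries_ge0 => k _ _; exact: g0.
have mG : measurable_fun [set: T] G.
  by apply: (@ge0_emeasurable_sum _ _ _ _ g xpredT) => // k t _ _; exact: g0.
have IG : (\int[mu]_t G t <= 1)%E.
  rewrite integral_nneseries//.
  apply: (@le_trans _ _ (\sum_(0 <= k <oo) (0 + (1 / (2 ^ k.+1)%:R)%:E))%E).
    apply: lee_nneseries => [k _ _|k _]; last exact: Ig.
    by apply: integral_ge0 => t _; exact: g0.
  apply: le_trans (@epsilon_trick R (fun=> 0%E) 1 xpredT (fun=> lexx _) ler01) _.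
  by rewrite (_ : (\sum_(0 <= i <oo) 0 = 0 :> \bar R)%E) ?add0e// eseries0.
have g_le k t : (g k t <= G t)%E.
  apply: le_trans (nneseries_lim_ge (P := xpredT) k.+1 _); last by move=> n _ _; exact: g0.
  rewrite big_nat_recr//= -[leLHS]add0e leeD2r// sume_ge0// => n _; exact: g0.
have mA' : measurable [set t | (G t < +oo)%E].
  by rewrite -[X in measurable X]setTI; exact: emeasurable_fun_infty_o.
pose A := [set t | (G t < +oo)%E].
have iG : mu.-integrable [set: T] G.
  apply/integrableP; split=> //.
  under eq_integral => t _ do rewrite gee0_abs//.
  exact: le_lt_trans IG (ltry _).
have aeA : {ae mu, forall t, A t}.
  have := integrable_ae measurableT iG; apply: filterS => t /(_ I).
  by rewrite ge0_fin_numE.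
(* Since [G] dominates each [g k], its p-th root bounds the weighted increments, wherever [G] is
   finite. *)
pose s t := fine (G t) `^ p^-1.
have s_ge0 t : 0 <= s t by exact: powR_ge0.
have sp t : A t -> ((s t `^ p)%:E = G t)%E.
  move=> At; rewrite /s -powRrM mulVf ?gt_eqF// powRr1 ?fine_ge0//.
  by rewrite fineK// ge0_fin_numE.
have incr t k : A t -> rnorm (f k.+1 t - f k t : R[i]^o) <= s t / 2 ^+ k.
  move=> At; rewrite ler_pdivlMr ?exprn_gt0// mulrC.
  have := g_le k t; rewrite -sp// lee_fin => h.
  rewrite leNgt; apply/negP => hs; move: h; rewrite leNgt => /negP; apply.
  by apply: gt0_ltr_powR; rewrite ?nnegrE ?mulr_ge0 ?exprn_ge0 ?rnorm_ge0 ?powR_ge0.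
have lim_ex t : A t -> exists2 l : R[i]^o, (fun k => f k t : R[i]^o) @ \oo --> l &
    forall n, rnorm (l - f n t : R[i]^o) <= 2 * s t / 2 ^+ n.
  move=> At; apply: geometric_increments_cvg; first exact: complex_seq_complete.
  by move=> k; exact: incr.
(* The limit is taken relative to [f 0], so that [2 * s] dominates it and it lies in [L_p] by
   itself; [v 0] is added back at the end. The value 0 off [A] makes it an everywhere limit of the
   measurable [w n]. *)
pose e t : R[i]^o := if pselect (A t) is left At then s2val (cid2 (lim_ex t At)) - f 0 t
  else 0.
have eA t n : A t -> rnorm (e t + f 0 t - f n t : R[i]^o) <= 2 * s t / 2 ^+ n.
  move=> At; rewrite /e; case: pselect => // At'; rewrite subrK.
  exact: (s2valP' (cid2 (lim_ex t At'))).
pose w n t : R[i]^o := if pselect (A t) is left _ then f n t - f 0 t else 0.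
have we t : (w n t) @[n --> \oo] --> e t.
  rewrite /w /e; case: pselect => [At|_]; last exact: cvg_cst.
  by apply: cvgB; [exact: (s2valP (cid2 (lim_ex t At)))|exact: cvg_cst].
have wA n t : w n t = (\1_A t : R)%:C * (f n t - f 0 t).
  rewrite /w indicE; case: pselect => At; first by rewrite mem_set// mul1r.
  by rewrite memNset// mul0r.
have m_Re n : measurable_fun [set: T] (fun t => complex.Re (w n t)).
  rewrite (_ : (fun t => _) = fun t => \1_A t * (complex.Re (f n t) - complex.Re (f 0 t))).
    apply: measurable_funM; first exact: measurable_indic.
    by apply: measurable_funB; exact: cLfun_meas_Re.
  by apply/funext => t; rewrite wA Re_scale raddfB.
have m_Im n : measurable_fun [set: T] (fun t => complex.Im (w n t)).
  rewrite (_ : (fun t => _) = fun t => \1_A t * (complex.Im (f n t) - complex.Im (f 0 t))).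
    apply: measurable_funM; first exact: measurable_indic.
    by apply: measurable_funB; exact: cLfun_meas_Im.
  by apply/funext => t; rewrite wA; case: (f n t) (f 0 t) => a b [c r] /=; ring.
have e_Re : measurable_fun [set: T] (fun t => complex.Re (e t)).
  apply: (measurable_fun_cvg m_Re) => t _; apply/cvg_Rseqn => r r0.
  have /cvg_seqP/(_ r r0)[N hN] := we t; exists N => n Nn.
  by apply: le_lt_trans (hN n Nn); rewrite -raddfB /= normr_Re_le.
have e_Im : measurable_fun [set: T] (fun t => complex.Im (e t)).
  apply: (measurable_fun_cvg m_Im) => t _; apply/cvg_Rseqn => r r0.
  have /cvg_seqP/(_ r r0)[N hN] := we t; exists N => n Nn.
  by apply: le_lt_trans (hN n Nn); rewrite -raddfB /= normr_Im_le.
have powG t n (z : R[i]) : A t -> rnorm (z : R[i]^o) <= 2 * s t / 2 ^+ n ->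
    ((rnorm (z : R[i]^o) `^ p)%:E <= ((2 / 2 ^+ n) `^ p)%:E * G t)%E.
  move=> At hz; have n0 : 0 <= 2 / 2 ^+ n :> R by rewrite divr_ge0// exprn_ge0.
  rewrite -sp// -EFinM lee_fin -powRM//.
  by apply: ler_powRl; rewrite ?rnorm_ge0// mulrAC.
have eP : e \in @cLfun_pred d T R mu p (ltW p1).
  rewrite inE /=; split=> //.
  apply: (@lty_poweRy _ _ p); first by rewrite gt_eqF.
  rewrite (powR_cLnorm mu p1).
  apply: (@le_lt_trans _ _ (\int[mu]_t (((2 / 2 ^+ 0) `^ p)%:E * G t))%E).
    apply: ge0_le_integral => //.
    - by move=> t _; rewrite lee_fin powR_ge0.
    - apply/measurable_EFinP; apply: (measurableT_comp (measurable_powR _)).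
      exact: measurable_rnorm.
    - exact: measurable_funeM.
    - move=> t _; have [At|nA] := pselect (A t).
        by apply: powG => //; have := eA t 0 At; rewrite addrK.
      rewrite /e; case: pselect => // _; rewrite rnorm0 powR0 ?gt_eqF//.
      by rewrite mule_ge0// lee_fin powR_ge0.
  rewrite ge0_integralZl_EFin ?powR_ge0//.
  by rewrite lte_mul_pinfty ?lee_fin ?powR_ge0// (le_lt_trans IG)// ltry.
pose E : F := CLfun eP.
exists (\pi_X E + v 0).
have dist n : rnorm (\pi_X E + v 0 - v n) <= 2 / 2 ^+ n.
  have hae : {ae mu, forall t, repr (\pi_X E + v 0 - v n) t = (E + f 0 - f n) t}.
    suff -> : \pi_X E + v 0 - v n = \pi_X (E + f 0 - f n) by exact: repr_pi_ae.
    by rewrite raddfB raddfD /= /f !reprK.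
  rewrite leNgt; apply/negP => hlt.
  have n0 : 0 <= 2 / 2 ^+ n :> R by rewrite divr_ge0// exprn_ge0.
  have : (2 / 2 ^+ n) `^ p < rnorm (\pi_X E + v 0 - v n) `^ p.
    by apply: gt0_ltr_powR; rewrite ?nnegrE ?rnorm_ge0.
  apply/negP; rewrite -leNgt -lee_fin (powR_rnorm_ae hae).
  apply: (@le_trans _ _ (\int[mu]_t (((2 / 2 ^+ n) `^ p)%:E * G t))%E).
    apply: ae_ge0_le_integral => //.
    - by move=> t _; rewrite lee_fin powR_ge0.
    - exact: cLfun_meas_powR.
    - by move=> t _; rewrite mule_ge0// lee_fin powR_ge0.
    - exact: measurable_funeM.
    - by apply: filterS aeA => t At _; apply: powG => //; exact: eA.
  rewrite ge0_integralZl_EFin ?powR_ge0// -[leRHS]mule1.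
  by rewrite lee_wpmul2l// lee_fin powR_ge0.
apply/cvg_seqP => r r0.
have : 2 / 2 ^+ n @[n --> \oo] --> (0 : R).
  under eq_fun do rewrite -exprVn.
  by apply: (@cvg_geometric R 2 2^-1); rewrite ger0_norm ?invr_ge0// invf_lt1 // ltr1n.
move=> /cvg_Rseqn/(_ r r0)[N hN]; exists N => n Nn; rewrite rnormBC.
apply: (le_lt_trans (dist n)); apply: le_lt_trans (hN n Nn).
by rewrite subr0 ler_norm.
Qed.

Lemma cLspace_complete : seq_complete (X : normedModType R[i]).
Proof.
move=> u uC.
pose N k := sval (cid (uC (K k) (K_gt0 k))).
have NP k m n : (N k <= m)%N -> (N k <= n)%N -> rnorm (u m - u n) < K k.
  by move=> hm hn; exact: (svalP (cid (uC (K k) (K_gt0 k)))).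
(* A running maximum, so that [M k] and [M k.+1] both lie beyond [N k]. *)
pose M k := (\max_(i < k.+1) N i)%N.
have NM j k : (j <= k)%N -> (N j <= M k)%N.
  by move=> jk; apply: (@leq_bigmax _ (fun i : 'I_k.+1 => N i) (Ordinal (jk : (j < k.+1)%N))).
have [|l /cvg_seqP ul] := @cLspace_fast_cvg (fun k => u (M k)).
  by move=> k; apply/ltW/NP; exact: NM.
exists l; apply/cvg_seqP => e e0; have e20 : 0 < e / 2 by rewrite divr_gt0.
have [N2 h2] := ul _ e20.
have : 1 / 2 ^+ n @[n --> \oo] --> (0 : R).
  under eq_fun do rewrite -exprVn.
  by apply: (@cvg_geometric R 1 2^-1); rewrite ger0_norm ?invr_ge0// invf_lt1 // ltr1n.
move=> /cvg_Rseqn/(_ _ e20)[N3 h3].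
pose k := maxn N2 N3; exists (N k) => n Nn.
apply: (le_lt_trans (rnormBD (u (M k)) _ _)).
have := h2 k (leq_maxl _ _); have := NP k n (M k) Nn (NM k k (leqnn k)).
have := h3 k (leq_maxr _ _); rewrite subr0 => /(le_lt_trans (ler_norm _)).
have : K k <= 1 / 2 ^+ k.
  by rewrite /K ler_pM2r ?invr_gt0 ?exprn_gt0// ler_pdivrMr ?ltr0n ?expn_gt0// mul1r ler1n expn_gt0.
lra.
Qed.

End LpComplete.

(** If [L_p] is zero, there are no duality pairs, hence no numerical strong peak functions, and
    density fails; [Lp_neq0] excludes this case. *)
Theorem corollary2p23 (R : realType) (d : measure_display) (T : measurableType d)
    (mu : {measure set T -> \bar R}) (p : R) (p1 : 1 < p)
    (Lp_neq0 : exists x : cLspace mu (ltW p1), x != 0) (k : ball_class) :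
  let X : normedModType R[i] := cLspace mu (ltW p1) in
  let S : set (ball_algebra X k) :=
    [set f | norm_strong_peak f /\ numerical_strong_peak f] in
  [/\ Gdelta S, dense S &
      forall f : ball_algebra X k,
        numerical_strong_peak f -> very_strong_numerical_peak f].
Proof.
exact: (@strong_peak_functions_generic R (cLspace mu (ltW p1)) k p p1
  (@cLspace_unif_convex _ _ _ mu p p1) (@cLspace_unif_smooth _ _ _ mu p p1)
  (@cLspace_complete _ _ _ mu p p1) Lp_neq0).
Qed.
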